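(* Define the function $V:[-2,2]\to\mathbb{R}$ by $V(-\delta)=V(\delta)$ and \[ V(\delta) = \begin{cases} 4 - 2\delta - \delta^2 + \delta^2 \log(1+\delta) - 2(1-\delta)\log(1-\delta), & \text{if } 0 \le \delta < 1, \\ 1+\log 2, & \text{if } \delta=1, \\ 4 - 2\delta - \delta^2 + \delta^2 \log(\delta+1) + 2(\delta-1)\log(\delta-1), & \text{if } 1 < \delta \le \sqrt2, \\ \delta^2 - 2\delta - (\delta^2-2\delta+2) \log(\delta-1), & \text{if } \sqrt{2} < \delta \le 2, \end{cases} \] where $\log$ is the natural logarithm. Then for every integer $k\ge 1$ and every integer $\lambda$ with $-2k\le\lambda\le 2k$, \[ |\mathcal{M}^\lambda_2(k)| = \frac{24\,V(\lambda/k)}{\pi^2}\, k^2 \log k + O(k^2), \] where the implied constant is absolute (in particular, independent of $\lambda$ and $k$). On the other hand, if $|\lambda|>2k$ then $\mathcal{M}^\lambda_2(k)$ is empty.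
   Context: For an integer $k\ge1$, $\mathcal{M}_2(k)$ denotes the set of $2\times2$ matrices all of whose entries are integers of absolute value at most $k$. For an integer $\lambda$, $\mathcal{M}^\lambda_2(k) = \{M\in\mathcal{M}_2(k) : \lambda \text{ is an eigenvalue of } M\}$. *)

(* Defs.v *)
From HB Require Import structures.
From mathcomp Require Import all_boot all_order all_algebra finmap.
From mathcomp Require Import all_classical all_reals all_analysis.

Set Implicit Arguments.
Unset Strict Implicit.
Unset Printing Implicit Defensive.

Import Order.TTheory GRing.Theory Num.Theory.

Local Open Scope classical_set_scope.
Local Open Scope ring_scope.

Definition M2 (k : nat) : set 'M[int]_2 :=
  [set M | forall i j, `|M i j| <= k%:Z].

(* [eigenvalue] requires coefficients in a field, hence the passage to [rat];
   whether the integer [l] is an eigenvalue, i.e. whether M - l is singular,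
   does not depend on the extension field of [rat] that is used. *)
Definition M2eig (k : nat) (l : int) : set 'M[int]_2 :=
  [set M | M2 k M /\ eigenvalue (map_mx (intr : int -> rat) M) l%:~R].

(* Finiteness matters because [fset_set] of an infinite set is [fset0]. *)
Lemma finite_M2 (k : nat) : finite_set (M2 k).
Proof.
pose f (g : {ffun 'I_2 * 'I_2 -> 'I_(k + k).+1}) : 'M[int]_2 :=
  \matrix_(i, j) ((g (i, j))%:Z - k%:Z).
apply: (@sub_finite_set _ _ (f @` setT)); last first.
  exact/finite_image/finite_finset.
move=> M /= hM.
have h i j : 0 <= M i j + k%:Z <= (k + k)%:Z.
  have := hM i j; rewrite ler_norml => /andP[h1 h2].
  by rewrite -lerBlDr sub0r h1 PoszD lerD2r.
exists [ffun p => inord (absz (M p.1 p.2 + k%:Z))] => //.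
apply/matrixP => i j; rewrite !mxE ffunE /=.
have /andP[h0 h1] := h i j.
rewrite inordK ?gez0_abs ?addrK // ltnS -lez_nat gez0_abs //.
Qed.

Lemma finite_M2eig (k : nat) (l : int) : finite_set (M2eig k l).
Proof. by apply: sub_finite_set (finite_M2 k) => M []. Qed.

(* The function is only meant on [-2, 2]; its values at other points are
   irrelevant. The absolute value encodes V (- x) = V x. *)
Definition V (R : realType) (x : R) : R :=
  let d := `|x| in
  if d < 1 then
    4 - 2 * d - d ^+ 2 + d ^+ 2 * ln (1 + d) - 2 * (1 - d) * ln (1 - d)
  else if d == 1 then
    1 + ln 2
  else if d <= Num.sqrt 2 then
    4 - 2 * d - d ^+ 2 + d ^+ 2 * ln (d + 1) + 2 * (d - 1) * ln (d - 1)
  else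
    d ^+ 2 - 2 * d - (d ^+ 2 - 2 * d + 2) * ln (d - 1).

(* Main.v *)
Require Import Defs.
From mathcomp Require Import all_boot all_order all_algebra finmap.
From mathcomp Require Import all_classical all_reals all_analysis.
From mathcomp Require Import ring lra zify.

(* Put x = l - a and y = l - d for M = [[a, b], [c, d]]: the integer l is an
   eigenvalue iff x y = b c. Up to O(k^2) solutions with a zero entry, x : b and
   c : y are the same fraction +-p : q in lowest terms, so the count is
   2 sum G(p,q) G(q,p) over coprime p, q, where G(p,q) is the number of g <> 0
   with |l - g p| <= k and |g q| <= k. Here G(p,q) = k ell(p,q) + O(1) for the
   length ell(p,q) of an intersection of two intervals, homogeneous of degree -1,
   whence G(p,q) G(q,p) is about k^2 h(p/q) / q^2. The profile h is a product of
   two bounded monotone functions with integral V(l/k) over [0, 1], so the sum of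
   h(p/q) / q^2 over all p <= q <= n is V(l/k) log n + O(1), uniformly in l/k.
   Sorting the pairs by their gcd d expresses this as the sum over d of
   S(n/d) / d^2, where S is the sum over coprime pairs; since the sum of 1/d^2
   over d >= 2 is less than 1, induction on n gives
   S(n) = V(l/k) log n / zeta(2) + O(1), and zeta(2) = pi^2/6. *)

Set Implicit Arguments.
Unset Strict Implicit.
Unset Printing Implicit Defensive.

Import Order.TTheory GRing.Theory Num.Theory.
Import numFieldNormedType.Exports.

Local Open Scope classical_set_scope.
Local Open Scope ring_scope.

(** * Partial sums of zeta(2), of the harmonic series and of log d / d^2 *)

Section Basel.
Variable R : realType.
Implicit Types x y : R.

(** This is csc^2. It stays within 1 of 1/x^2 near 0 while its sum over equally spaced points has a
    closed form; comparing the two evaluates zeta(2). *)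
Definition sqcsc x : R := (sin x ^+ 2)^-1.

Lemma le_sin x : 0 <= x -> sin x <= x.
Proof.
rewrite le_eqVlt => /predU1P[<-|x0]; first by rewrite sin0.
have [|c _] := @MVT R sin cos 0 x x0 (fun y _ => is_derive_sin y).
  exact/continuous_subspaceT/continuous_sin.
rewrite sin0 !subr0 => ->.
by rewrite ler_piMl ?cos_le1 // ltW.
Qed.

(** Equivalent to x <= tan x, which the mean value theorem gives because tan has derivative 1/cos^2
    >= 1. *)
Lemma le_xcos_sin x : 0 < x < pi / 2 -> x * cos x <= sin x.
Proof.
move=> /andP[x0 xpi].
have cx : 0 < cos x.
  apply: cos_gt0_pihalf; rewrite xpi andbT.
  by rewrite (lt_trans _ x0)// oppr_lt0 divr_gt0 ?pi_gt0.
have hc y : y \in `[0, x] -> cos y != 0.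
  rewrite in_itv /= => /andP[y0 yx]; rewrite gt_eqF // cos_gt0_pihalf //.
  rewrite (le_lt_trans yx xpi) andbT.
  by rewrite (lt_le_trans _ y0)// oppr_lt0 divr_gt0 ?pi_gt0.
have [| |c] := @MVT R tan (fun y => (cos y)^-2) 0 x x0.
- move=> y yx; apply: is_derive_tan; apply: hc.
  by move: yx; rewrite !in_itv /= => /andP[/ltW -> /ltW ->].
- apply: derivable_within_continuous => y yx.
  exact/derivable_tan/hc.
rewrite in_itv /= => /andP[c0 cx'] E.
have : x <= tan x.
  have -> : tan x = tan x - tan 0 by rewrite tan0 subr0.
  rewrite E subr0 ler_peMl ?(ltW x0) //.
  have cc : 0 < cos c.
    rewrite cos_gt0_pihalf // (lt_trans cx' xpi) andbT.
    by rewrite (lt_trans _ c0)// oppr_lt0 divr_gt0 ?pi_gt0.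
  rewrite invf_ge1 ?exprn_gt0 // exprn_ile1 ?cos_le1 //; exact: ltW.
by rewrite /tan ler_pdivlMr.
Qed.

(** The lower bound is sin x <= x. The upper one comes from csc^2 = cot^2 + 1 and cot x <= 1/x. *)
Lemma sqcsc_bounds x : 0 < x < pi / 2 ->
  (x ^+ 2)^-1 <= sqcsc x <= (x ^+ 2)^-1 + 1.
Proof.
move=> hx; have /andP[x0 xpi] := hx.
have s0 : 0 < sin x by exact: sin_gt0_pihalf.
have c0 : 0 < cos x.
  rewrite cos_gt0_pihalf // xpi andbT.
  by rewrite (lt_trans _ x0)// oppr_lt0 divr_gt0 ?pi_gt0.
apply/andP; split.
  by rewrite lef_pV2 ?posrE ?exprn_gt0 // lerXn2r ?nnegrE ?le_sin // ltW.
rewrite /sqcsc.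
have e : (sin x ^+ 2)^-1 = (cos x / sin x) ^+ 2 + 1.
  rewrite exprMn cos2sin2 exprVn mulrBl mul1r divff ?subrK //.
  by rewrite expf_neq0 // gt_eqF.
rewrite e lerD2r -exprVn lerXn2r ?nnegrE ?divr_ge0 ?invr_ge0 ?(ltW x0) ?(ltW c0) ?(ltW s0) //.
rewrite ler_pdivrMr // mulrC ler_pdivlMr // mulrC.
exact: le_xcos_sin.
Qed.

(** Reflection in pi/4 exchanges sin and cos, so the left side is 1/sin^2 + 1/cos^2 = 1/(sin cos)^2,
    and sin 2x = 2 sin x cos x. *)
Lemma sqcsc_double x : sin x != 0 -> cos x != 0 ->
  sqcsc x + sqcsc (pi / 2 - x) = 4 * sqcsc (x *+ 2).
Proof.
move=> s0 c0; rewrite /sqcsc sin_mulr2n sinB sin_pihalf cos_pihalf mul1r mul0r subr0.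
have e : 1 = cos x ^+ 2 + sin x ^+ 2 :> R by rewrite cos2Dsin2.
rewrite -[(cos x * sin x) *+ 2]mulr_natl !exprMn.
transitivity ((cos x ^+ 2 + sin x ^+ 2) / (cos x ^+ 2 * sin x ^+ 2)).
  by field; rewrite s0 c0.
by rewrite -e; field; rewrite s0 c0.
Qed.


(* The terms k and 2^(n+1) - k of the next sum add up to 4 times the term k of
   this one, and its middle term is csc^2(pi/4) = 2. *)
Lemma sum_sqcsc n :
  \sum_(1 <= k < 2 ^ n) sqcsc (k%:R * pi / 2 ^+ n.+1) = 2 / 3 * (4 ^+ n - 1).
Proof.
elim: n => [|n IH]; first by rewrite big_geq // expr0 subrr mulr0.
have pn : (0 < 2 ^ n)%N by rewrite expn_gt0.
have E2 : (2 ^ n.+1 = 2 ^ n + 2 ^ n)%N by rewrite expnS mul2n addnn.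
have R2 m : 2 ^+ m = (2 ^ m)%:R :> R by rewrite natrX.
have nz : 2 ^+ n != 0 :> R by rewrite expf_neq0.
set x := fun k : nat => k%:R * pi / 2 ^+ n.+2 : R.
rewrite (@big_cat_nat _ _ _ (2 ^ n)) //=; last by rewrite E2 leq_addr.
rewrite (@big_cat_nat _ _ _ (2 ^ n).+1 (2 ^ n)) //=; last first.
  by rewrite E2 -addn1 leq_add2l.
rewrite big_nat1.
have -> : sqcsc (x (2 ^ n)%N) = 2.
  have -> : x (2 ^ n)%N = pi / 4.
    by rewrite /x natrX !exprS; field; rewrite nz.
  have := @sqcsc_double (pi / 4).
  have -> : pi / 2 - pi / 4 = pi / 4 :> R by field.
  have -> : (pi / 4) *+ 2 = pi / 2 :> R by rewrite -mulr_natl; field.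
  have p0 := pi_gt0 R.
  have hs : sin (pi / 4) != 0 :> R by rewrite gt_eqF // sin_gt0_pihalf //; lra.
  have hc : cos (pi / 4) != 0 :> R by rewrite gt_eqF // cos_gt0_pihalf //; lra.
  move=> /(_ hs hc); rewrite {3}/sqcsc sin_pihalf expr1n invr1; lra.
have -> : \sum_((2 ^ n).+1 <= k < 2 ^ n.+1) sqcsc (x k) =
   \sum_(1 <= k < 2 ^ n) sqcsc (pi / 2 - x k).
  rewrite -[(2 ^ n).+1]add1n big_addn E2 addnK big_nat_rev /=.
  apply: eq_big_nat => k /andP[k1 k2]; congr sqcsc.
  have -> : (1 + 2 ^ n - k.+1 + 2 ^ n = 2 ^ n.+1 - k)%N by rewrite E2; lia.
  rewrite /x natrB ?E2; last by lia.
  by rewrite -E2 -R2 !exprS; field; rewrite nz.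
rewrite addrCA -big_split /=.
rewrite (eq_big_nat _ _ (F2 := fun k => 4 * sqcsc (k%:R * pi / 2 ^+ n.+1))).
  rewrite -mulr_sumr IH [4 ^+ n.+1]exprS; lra.
move=> k /andP[k1 k2].
have p0 := pi_gt0 R.
have hx : 0 < x k < pi / 2.
  have k0 : 0 < k%:R :> R by rewrite ltr0n.
  have k2' : k%:R <= 2 ^+ n :> R by rewrite R2 ler_nat ltnW.
  have n0 : 0 < 2 ^+ n :> R by rewrite exprn_gt0.
  apply/andP; split; first by rewrite /x !mulr_gt0 // invr_gt0 exprn_gt0.
  rewrite /x ltr_pdivrMr ?exprn_gt0 // !exprS.
  have h1 : k%:R * pi <= 2 ^+ n * pi :> R by rewrite ler_pM2r.
  have h2 : 0 < 2 ^+ n * pi :> R by rewrite mulr_gt0.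
  lra.
rewrite sqcsc_double.
- by congr (_ * sqcsc _); rewrite /x -mulr_natl !exprS; field; rewrite nz.
- by rewrite gt_eqF // sin_gt0_pihalf.
- rewrite gt_eqF // cos_gt0_pihalf //.
  by case/andP: hx; rewrite -/(x k); move: (x k) => y; lra.
Qed.

(** Apply [sqcsc_bounds] at the points k pi / (2 N), N = 2^m, and sum with [sum_sqcsc]. The errors
    of at most 1 per term total less than N, which becomes O(1/N) after scaling by pi^2 / (4
    N^2). *)
Lemma pow2_basel m :
  (pi ^+ 2 / 6 - pi ^+ 2 / 2 ^+ m : R)
    <= \sum_(1 <= k < 2 ^ m) (k%:R ^+ 2)^-1 <= (pi ^+ 2 / 6 : R).
Proof.
set N : R := 2 ^+ m; set B := bigop _ _ _.
have p0 := pi_gt0 R.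
have N1 : 1 <= N by rewrite exprn_ege1 //; lra.
have N0 : 0 < N by lra.
have hb k : (1 <= k < 2 ^ m)%N ->
  4 * N ^+ 2 / pi ^+ 2 * (k%:R ^+ 2)^-1 <= sqcsc (k%:R * pi / 2 ^+ m.+1)
    <= 4 * N ^+ 2 / pi ^+ 2 * (k%:R ^+ 2)^-1 + 1.
  move=> /andP[k1 k2].
  have k0 : 0 < k%:R :> R by rewrite ltr0n.
  have kN : k%:R + 1 <= N by rewrite /N -natrX natr1 ler_nat.
  have -> : 4 * N ^+ 2 / pi ^+ 2 * (k%:R ^+ 2)^-1
     = ((k%:R * pi / 2 ^+ m.+1) ^+ 2)^-1.
    by rewrite [2 ^+ m.+1]exprS -/N; move: (pi : R) p0 => P P0; field; rewrite !gt_eqF.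
  apply: sqcsc_bounds; rewrite [2 ^+ m.+1]exprS -/N; apply/andP; split.
    by rewrite !mulr_gt0 // invr_gt0 mulr_gt0.
  rewrite ltr_pdivrMr; last by lra.
  have -> : pi / 2 * (2 * N) = N * pi by move: (pi : R) => P; field.
  by rewrite ltr_pM2r //; lra.
have E : 4 ^+ m = N ^+ 2 by rewrite /N -exprM mulnC exprM; congr (_ ^+ _); ring.
have := sum_sqcsc m; rewrite E => S.
have lo : 4 * N ^+ 2 / pi ^+ 2 * B <= 2 / 3 * (N ^+ 2 - 1).
  rewrite -S mulr_sumr big_nat [leRHS]big_nat.
  by apply: ler_sum => k /hb /andP[].
have up : 2 / 3 * (N ^+ 2 - 1) <= 4 * N ^+ 2 / pi ^+ 2 * B + N.
  have NE : N = \sum_(1 <= k < 2 ^ m) 1 + 1.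
    rewrite sumr_const_nat natrB ?expn_gt0 // subrK /N natrX //.
  rewrite -S {2}NE mulr_sumr addrA -big_split /= -[leLHS]addr0 lerD //.
  rewrite big_nat [leRHS]big_nat.
  by apply: ler_sum => k /hb /andP[].
have e : B = pi ^+ 2 / (4 * N ^+ 2) * (4 * N ^+ 2 / pi ^+ 2 * B).
  by clearbody B;  move: (pi : R) p0 => P P0; field; rewrite !gt_eqF.
have c0 : 0 < pi ^+ 2 / (4 * N ^+ 2) :> R.
  by rewrite divr_gt0 ?mulr_gt0 ?exprn_gt0.
have p20 : 0 < pi ^+ 2 :> R by rewrite exprn_gt0.
apply/andP; split.
  rewrite e.
  have h : pi ^+ 2 / (4 * N ^+ 2) * (2 / 3 * (N ^+ 2 - 1) - N) <= B.
    by rewrite e ler_pM2l // lerBlDr.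
  rewrite -e; apply: le_trans h.
  rewrite -subr_ge0.
  have -> : pi ^+ 2 / (4 * N ^+ 2) * (2 / 3 * (N ^+ 2 - 1) - N) -
     (pi ^+ 2 / 6 - pi ^+ 2 / N) = pi ^+ 2 / N ^+ 2 * (3 / 4 * N - 1 / 6).
    by move: (pi : R) p0 => P P0; field; rewrite !gt_eqF.
  by rewrite mulr_ge0 ?divr_ge0 ?exprn_ge0 ?(ltW p0) ?(ltW N0) //; lra.
apply: le_trans (_ : pi ^+ 2 / (4 * N ^+ 2) * (2 / 3 * (N ^+ 2 - 1)) <= _).
  by rewrite {1}e ler_pM2l.
rewrite -subr_ge0.
have -> : pi ^+ 2 / 6 - pi ^+ 2 / (4 * N ^+ 2) * (2 / 3 * (N ^+ 2 - 1)) =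
  pi ^+ 2 / N ^+ 2 / 6 by move: (pi : R) p0 => P P0; field; rewrite !gt_eqF.
by rewrite !divr_ge0 ?exprn_ge0 ?(ltW p0) ?(ltW N0).
Qed.

(** The partial sums increase, so n is enclosed between consecutive powers of 2. With pi <= 4 and n
    <= 2 * 2^m, the error pi^2 / 2^m is at most 32 / n. *)
Lemma basel n : (0 < n)%N ->
  (pi ^+ 2 / 6 - 32 / n%:R : R) <= \sum_(1 <= k < n.+1) (k%:R ^+ 2)^-1
    <= (pi ^+ 2 / 6 : R).
Proof.
move=> n0; have /andP[m1 m2] := trunc_log_bounds (isT : (1 < 2)%N) n0.
set m := trunc_log 2 n in m1 m2.
have mono a b : (1 <= a <= b)%N ->
  \sum_(1 <= k < a) (k%:R ^+ 2)^-1 <= \sum_(1 <= k < b) (k%:R ^+ 2)^-1 :> R.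
  move=> /andP[a1 ab]; rewrite [leRHS](@big_cat_nat _ _ _ a) //= lerDl.
  by apply: sumr_ge0 => k _; rewrite invr_ge0 exprn_ge0.
apply/andP; split; last first.
  apply: le_trans (proj2 (andP (pow2_basel m.+1))).
  by apply: mono; rewrite /= m2.
apply: le_trans (_ : \sum_(1 <= k < 2 ^ m) (k%:R ^+ 2)^-1 <= _); last first.
  by apply: mono; rewrite expn_gt0 /= ltnW.
apply: le_trans (proj1 (andP (pow2_basel m))).
rewrite lerD2l lerN2.
have n0' : 0 < n%:R :> R by rewrite ltr0n.
have N0 : 0 < 2 ^+ m :> R by rewrite exprn_gt0.
have nN : n%:R <= 2 * 2 ^+ m :> R.
  by rewrite -exprS -natrX ler_nat ltnW.
have p4 : pi ^+ 2 <= 16 :> R.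
  have := pi_gt0 R; have := pihalf_lt2 R => h1 h2.
  have : pi <= 4 :> R by lra.
  move=> h; rewrite expr2; nra.
rewrite ler_pdivrMr // mulrAC ler_pdivlMr //.
apply: le_trans (_ : 16 * n%:R <= _); first by rewrite ler_pM2r.
lra.
Qed.

Lemma lnS_le n : (0 < n)%N -> ln n.+1%:R <= ln n%:R + n%:R^-1 :> R.
Proof.
move=> n0; have n0' : 0 < n%:R :> R by rewrite ltr0n.
have := @le_ln1Dx R (n%:R^-1).
have -> : 1 + n%:R^-1 = n.+1%:R / n%:R :> R by rewrite -natr1; field; rewrite gt_eqF.
rewrite ln_div ?posrE ?ltr0n // lerBlDl; apply.
have : 0 < n%:R^-1 :> R by rewrite invr_gt0.
lra.
Qed.

Lemma lnS_ge n : (0 < n)%N -> ln n%:R + n.+1%:R^-1 <= ln n.+1%:R :> R.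
Proof.
move=> n0; have n0' : 0 < n%:R :> R by rewrite ltr0n.
have := @le_ln1Dx R (- n.+1%:R^-1).
have -> : 1 - n.+1%:R^-1 = n%:R / n.+1%:R :> R.
  by rewrite -natr1; field; apply/eqP => h; lra.
rewrite ln_div ?posrE ?ltr0n // => h.
have : ln n%:R - ln n.+1%:R <= - n.+1%:R^-1 :> R.
  by apply: h; rewrite ltrN2 invf_lt1 ?ltr1n ?ltr0n.
by move: n.+1%:R^-1 (ln n%:R) (ln n.+1%:R) => c a b; lra.
Qed.

Lemma harmonic_ln n : (0 < n)%N ->
  (ln n%:R : R) <= \sum_(1 <= k < n.+1) k%:R^-1 <= (1 + ln n%:R : R).
Proof.
case: n => // n _; apply/andP; split.
  apply: le_trans (_ : \sum_(1 <= k < n.+1) k%:R^-1 <= _); last first.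
    by rewrite [leRHS]big_nat_recr //= lerDl invr_ge0.
  elim: n => [|n IH]; first by rewrite big_geq // ln1.
  by rewrite big_nat_recr //= (le_trans (@lnS_le n.+1 isT)) // lerD2r.
elim: n => [|n IH]; first by rewrite big_nat1 invr1 ln1 addr0.
rewrite big_nat_recr //= (le_trans (lerD IH (lexx _))) //.
by rewrite -addrA lerD2l lnS_ge.
Qed.

Lemma sum_sqV_le n : \sum_(2 <= k < n.+1) (k%:R ^+ 2)^-1 <= 3 / 4 :> R.
Proof.
(* The stronger bound 3/4 - 1/n passes through the induction, since 1/(n+1)^2 <= 1/n - 1/(n+1). That
   the total is below 1 is what makes [renewal] a contraction. *)
suff h m : \sum_(2 <= k < m.+3) (k%:R ^+ 2)^-1 <= 3 / 4 - m.+2%:R^-1 :> R.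
  case: n => [|[|n]]; [by rewrite big_geq ?divr_ge0 | by rewrite big_geq ?divr_ge0 | ].
  by rewrite (le_trans (h n)) // lerBlDr lerDl invr_ge0.
elim: m => [|m IH]; first by rewrite big_nat1 expr2; lra.
rewrite big_nat_recr //= (le_trans (lerD IH (lexx _))) //.
rewrite -subr_ge0 -[m.+3%:R]natr1.
have : 0 < m.+2%:R :> R by rewrite ltr0n.
move: m.+2%:R => x x0.
have -> : 3 / 4 - (x + 1)^-1 - (3 / 4 - x^-1 + ((x + 1) ^+ 2)^-1) =
  (x * (x + 1) ^+ 2)^-1 by field; rewrite !gt_eqF //; lra.
by rewrite invr_ge0 mulr_ge0 ?exprn_ge0 //; lra.
Qed.

Lemma sum_ln_sqV_le n :
  \sum_(1 <= d < n.+1) ln d%:R / d%:R ^+ 2 <= 2 :> R.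
Proof.
(* (2 + ln d) / d has decrements at least ln d / d ^ 2. *)
suff h m : \sum_(1 <= d < m.+2) ln d%:R / d%:R ^+ 2 <=
    2 - (2 + ln m.+1%:R) / m.+1%:R :> R.
  case: n => [|n]; first by rewrite big_geq.
  rewrite (le_trans (h n)) // lerBlDr lerDl divr_ge0 // addr_ge0 //.
  by rewrite ln_ge0 // ler1n.
elim: m => [|m IH]; first by rewrite big_nat1 ln1 divr1; lra.
rewrite big_nat_recr //= (le_trans (lerD IH (lexx _))) //.
have h := @lnS_le m.+1 isT.
have l0 : 0 <= ln m.+1%:R :> R by rewrite ln_ge0 // ler1n.
have l2 : 0 <= ln m.+2%:R :> R by rewrite ln_ge0 // ler1n.
move: h l0 l2; rewrite -[m.+2%:R]natr1.
have : 1 <= m.+1%:R :> R by rewrite ler1n.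
move: m.+1%:R => x x1; move: (ln x) (ln (x + 1)) => a b h a0 b0.
rewrite -subr_ge0.
have -> : 2 - (2 + b) / (x + 1) - (2 - (2 + a) / x + b / (x + 1) ^+ 2) =
  ((a + 2) * (x + 1) ^+ 2 - (2 + b) * x * (x + 1) - b * x) / (x * (x + 1) ^+ 2).
  by field; apply/andP; split; apply/eqP; lra.
rewrite divr_ge0 //; last by rewrite mulr_ge0 ?exprn_ge0 //; lra.
have h' : b * x <= a * x + 1.
  by have := ler_wpM2r (_ : 0 <= x) h; rewrite mulrDl mulVf ?gt_eqF; lra.
have : b * x * (x + 2) <= (a * x + 1) * (x + 2) by rewrite ler_wpM2r //; lra.
lra.
Qed.

End Basel.

(** * Riemann sums *)

Section Integral.
Variable R : realType.
Implicit Types (x y t a b c v w d : R) (h f g H : R -> R).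

(* [H] is a primitive of [h] in the sense of the mean value inequality, which is
   all that Riemann sums need and is stable under gluing of intervals. *)
Definition has_int h a b v := exists2 H,
  (forall x y m M, a <= x -> x <= y -> y <= b ->
     (forall t, x < t < y -> m <= h t <= M) ->
     m * (y - x) <= H y - H x <= M * (y - x)) & H b - H a = v.

Lemma has_int_cat h a c b v w : a <= c -> c <= b ->
  has_int h a c v -> has_int h c b w -> has_int h a b (v + w).
Proof.
move=> ac cb [H1 h1 <-] [H2 h2 <-].
(* Both primitives are shifted to vanish at [c], so that they glue; an interval with [c] inside is
   cut there. *)
exists (fun t => if t <= c then H1 t - H1 c else H2 t - H2 c); last first.
  rewrite ac; case: ifPn => [bc|_]; last by ring.
  by have -> : b = c by [apply/eqP; rewrite eq_le bc cb]; ring.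
move=> x y m M ax xy yb hm; case: (leP y c) => [yc|cy].
  rewrite (le_trans xy yc).
  by have := h1 x y m M ax xy yc hm; lra.
case: (leP x c) => [xc|cx].
  have /andP[p1 p2] : m * (c - x) <= H1 c - H1 x <= M * (c - x).
    apply: h1 => // t /andP[t1 t2]; apply: hm; rewrite t1.
    exact: lt_trans t2 cy.
  have /andP[q1 q2] : m * (y - c) <= H2 y - H2 c <= M * (y - c).
    apply: h2 => //; first exact: ltW.
    by move=> t /andP[t1 t2]; apply: hm; rewrite t2 (le_lt_trans xc t1).
  lra.
have := h2 x y m M (ltW cx) xy yb hm; lra.
Qed.

Lemma eq_has_int h g a b v : (forall t, a < t < b -> h t = g t) ->
  has_int h a b v -> has_int g a b v.
Proof.
move=> e [H h1 h2]; exists H => // x y m M ax xy yb hm; apply: h1 => // t ht.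
rewrite e; first exact: hm.
by case/andP: ht => t1 t2; rewrite (le_lt_trans ax t1) (lt_le_trans t2 yb).
Qed.

Lemma has_int_cst k a b : has_int (fun=> k) a b (k * (b - a)).
Proof.
exists (fun t => k * t) => [x y m M ax xy yb hm|]; last by rewrite mulrBr.
move: xy; rewrite le_eqVlt => /predU1P[<-|xy]; first by rewrite !subrr !mulr0 lexx.
have /andP[h1 h2] := hm ((x + y) / 2) ltac:(lra).
by rewrite -mulrBr !ler_wpM2r // subr_ge0 ltW.
Qed.

(** Every piece of the profile integrated below has this shape; the mean value theorem is applied to
    A t + B ln t - C / t. *)
Lemma has_int_log (A B C : R) a b : 0 < a -> a <= b ->
  has_int (fun t => A + B / t + C / t ^+ 2) a b
   (A * (b - a) + B * (ln b - ln a) + C * (a^-1 - b^-1)).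
Proof.
move=> a0 ab; pose H t := A * t + B * ln t - C * t^-1.
exists H => [x y m M ax xy yb hm|]; last by rewrite /H; ring.
move: xy; rewrite le_eqVlt => /predU1P[<-|xy]; first by rewrite !subrr !mulr0 lexx.
have dH t : 0 < t -> is_derive t 1 H (A + B / t + C / t ^+ 2).
  move=> t0; rewrite /H.
  have tn : t != 0 by rewrite gt_eqF.
  have D := is_derive1_ln t0.
  have D' : is_derive t 1 (fun x : R => x^-1) (- t ^- 2 *: 1) by exact: is_deriveV.
  apply: is_derive_eq.
  by rewrite /GRing.scale /=; field.
have [||z] := @MVT R H (fun t => A + B / t + C / t ^+ 2) x y xy.
- move=> t; rewrite in_itv /= => /andP[t1 _]; apply: dH.
  exact: lt_trans (lt_le_trans a0 ax) t1.
- apply: derivable_within_continuous => t; rewrite in_itv /= => /andP[t1 _].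
  by apply: ex_derive; apply: dH; rewrite (lt_le_trans a0) // (le_trans ax).
rewrite in_itv /= => /hm /andP[h1 h2] ->.
by rewrite !ler_wpM2r // subr_ge0 ltW.
Qed.

(* [s] is the direction of variation: 1 for nondecreasing, -1 for nonincreasing. *)
Definition bounded_monotone f :=
  (forall t, 0 < t <= 1 -> 0 <= f t <= 2) /\
  (exists2 s, `|s| <= 1 &
    forall x y, 0 < x -> x <= y -> y <= 1 -> `|f y - f x| = s * (f y - f x)).

(** On a cell the product deviates from its value at the right end by at most twice the increment of
    f plus twice that of g. By monotonicity the increments of each factor add up to at most 2,
    however fine the mesh is. *)
Lemma riemann_sum f g v n : bounded_monotone f -> bounded_monotone g ->
  has_int (fun t => f t * g t) 0 1 v -> (0 < n)%N ->
  `|\sum_(1 <= m < n.+1) f (m%:R / n%:R) * g (m%:R / n%:R) - n%:R * v| <= 12.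
Proof.
move=> [f2 [s s1 fs]] [g2 [s' s1' gs]] [H hH <-]; case: n => // n _.
have n0' : 0 < n.+1%:R :> R by rewrite ltr0n.
pose X m : R := m%:R / n.+1%:R.
have X0 m : (0 < m)%N -> 0 < X m by move=> m0; rewrite divr_gt0 // ltr0n.
have X1 m : (m <= n.+1)%N -> X m <= 1.
  by move=> mn; rewrite ler_pdivrMr // mul1r ler_nat.
have XS m : X m <= X m.+1 by rewrite ler_pM2r ?invr_gt0 // ler_nat.
have XB m : n.+1%:R * (X m.+1 - X m) = 1.
  by rewrite /X -mulrBl mulrCA divff ?gt_eqF // mulr1 -natrB // subSnn.
have -> : n.+1%:R * (H 1 - H 0) = \sum_(0 <= m < n.+1) n.+1%:R * (H (X m.+1) - H (X m)).
  rewrite -mulr_sumr telescope_sumr // /X divff ?gt_eqF // mul0r //.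
rewrite big_add1 /= -sumrB.
apply: le_trans (ler_norm_sum _ _ _) _.
rewrite big_nat_recl //=.
(* The first cell starts at 0, where nothing is assumed of [f] and [g]; there the term and the
   scaled integral both lie in [0, 4]. The remaining cells cost 2 * 2 for each factor. *)
have -> : 12 = 4 + (2 * 2 + 2 * 2) :> R by ring.
have b4 t : 0 < t <= 1 -> 0 <= f t * g t <= 4.
  move=> ht; have := f2 _ ht; have := g2 _ ht.
  move=> /andP[a1 a2] /andP[a3 a4]; rewrite mulr_ge0 //=.
  have -> : 4 = 2 * 2 :> R by ring.
  exact: ler_pM.
apply: lerD.
  have /andP[p1 p2] := hH (X 0%N) (X 1%N) 0 4 ltac:(by rewrite /X mul0r) (XS 0%N) (X1 1%N isT)
    ltac:(move=> t /andP[t1 t2]; apply: b4; apply/andP; split;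
       [by move: t1; rewrite /X mul0r | by apply: le_trans (X1 1%N isT); apply: ltW]).
  have q1 : n.+1%:R * (0 * (X 1%N - X 0%N)) <= n.+1%:R * (H (X 1%N) - H (X 0%N)).
    by rewrite ler_pM2l.
  have q2 : n.+1%:R * (H (X 1%N) - H (X 0%N)) <= n.+1%:R * (4 * (X 1%N - X 0%N)).
    by rewrite ler_pM2l.
  have := b4 (X 1%N) ltac:(by rewrite X0 // X1).
  move: q1 q2; rewrite mul0r mulr0 mulrCA XB mulr1 -/(X 1%N) => q1 q2 /andP[q3 q4].
  by rewrite ler_norml; lra.
have tel (u : R -> R) (r : R) : (forall t, 0 < t <= 1 -> 0 <= u t <= 2) -> `|r| <= 1 ->
   (forall x y, 0 < x -> x <= y -> y <= 1 -> `|u y - u x| = r * (u y - u x)) ->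
   \sum_(0 <= m < n) `|u (X m.+2) - u (X m.+1)| <= 2.
  move=> u2 r1 ur.
  have -> : \sum_(0 <= m < n) `|u (X m.+2) - u (X m.+1)|
      = r * \sum_(0 <= m < n) (u (X m.+2) - u (X m.+1)).
    rewrite mulr_sumr; apply: eq_big_nat => m /andP[_ mn].
    by rewrite ur ?X0 ?X1.
  rewrite (telescope_sumr (fun m => u (X m.+1))) //.
  apply: le_trans (ler_norm _) _; rewrite normrM.
  have /andP[h1 h2] := u2 (X n.+1) ltac:(by rewrite X0 // X1).
  have /andP[h3 h4] := u2 (X 1%N) ltac:(by rewrite X0 // X1).
  have h5 : `|u (X n.+1) - u (X 1%N)| <= 2 by rewrite ler_norml; lra.
  by rewrite -[leRHS]mul1r ler_pM.
apply: le_trans (_ : \sum_(0 <= m < n) (2 * `|f (X m.+2) - f (X m.+1)| +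
   2 * `|g (X m.+2) - g (X m.+1)|) <= _); last first.
  rewrite big_split /= -!mulr_sumr lerD // ler_pM2l //.
    exact: tel f2 s1 fs.
  exact: tel g2 s1' gs.
rewrite big_nat [leRHS]big_nat; apply: ler_sum => m /andP[_ mn].
rewrite -!/(X _).
set D := (X in _ <= X).
have key t : X m.+1 < t < X m.+2 ->
   f (X m.+2) * g (X m.+2) - D <= f t * g t <= f (X m.+2) * g (X m.+2) + D.
  move=> /andP[t1 t2].
  have hX1 := X0 m.+1 isT; have hX2 := X1 m.+2 mn.
  have t0 : 0 < t := lt_trans hX1 t1.
  have t11 : t <= 1 := le_trans (ltW t2) hX2.
  (* Monotonicity keeps [u t] between the values at the two ends of the cell. *)
  have clo (u : R -> R) (r : R) :
     (forall x y, 0 < x -> x <= y -> y <= 1 -> `|u y - u x| = r * (u y - u x)) ->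
     `|u t - u (X m.+2)| <= `|u (X m.+2) - u (X m.+1)|.
    move=> ur; rewrite distrC !ur ?(ltW t1) ?(ltW t2) ?XS //.
    have : 0 <= r * (u t - u (X m.+1)) by rewrite -ur ?(ltW t1).
    lra.
  have cf := clo f s fs; have cg := clo g s' gs.
  have /andP[F1 F2] := f2 t ltac:(by rewrite t0 t11).
  have /andP[G1 G2] := g2 (X m.+2) ltac:(by rewrite X0).
  rewrite -ler_distl.
  have -> : f t * g t - f (X m.+2) * g (X m.+2) =
     f t * (g t - g (X m.+2)) + (f t - f (X m.+2)) * g (X m.+2) by ring.
  apply: le_trans (ler_normD _ _) _; rewrite !normrM /D addrC lerD //.
    by rewrite mulrC ler_pM // ger0_norm.
  by rewrite ler_pM // ger0_norm.
have /andP[p1 p2] := hH (X m.+1) (X m.+2) _ _ (ltW (X0 m.+1 isT)) (XS m.+1) (X1 m.+2 mn) key.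
have {}p1 := ler_wpM2l (ltW n0') p1; have {}p2 := ler_wpM2l (ltW n0') p2.
move: p1 p2; rewrite ![n.+1%:R * (_ * (_ - _))]mulrCA XB !mulr1 => p1 p2.
by rewrite distrC ler_distl p1 p2.
Qed.

End Integral.

(** * The density profile and its integral *)

Section Density.
Variable R : realType.
Implicit Types (d t p q x y a c : R).

(* The length of [(d-1)/p, (d+1)/p] `&` [-1/q, 1/q]; with d = l/k this is 1/k times
   the length of the set of real g such that |l - g p| <= k and |g q| <= k. *)
Definition ell d p q : R :=
  Num.max 0 (Num.min ((d + 1) / p) q^-1 - Num.max ((d - 1) / p) (- q^-1)).

Lemma ell_ge0 d p q : 0 <= ell d p q.
Proof. by rewrite le_max lexx. Qed.

(** Reflection in 0 maps one pair of intervals to the other. *)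
Lemma ellN d p q : ell (- d) p q = ell d p q.
Proof.
rewrite /ell; congr (Num.max 0 _).
have -> : (- d + 1) / p = - ((d - 1) / p) by rewrite -mulNr opprB addrC.
have -> : (- d - 1) / p = - ((d + 1) / p) by rewrite -mulNr opprD.
by rewrite -[q^-1]opprK -!oppr_min -!oppr_max !opprK addrC.
Qed.

Lemma ell_scale d c p q : 0 < c -> ell d (c * p) (c * q) = ell d p q / c.
Proof.
move=> c0; have ci : 0 <= c^-1 by rewrite invr_ge0 ltW.
rewrite /ell [RHS]mulrC maxr_pMr // mulr0 mulrBr maxr_pMr // minr_pMr //.
by rewrite !invfM mulrN ![c^-1 * (_ / p)]mulrCA.
Qed.

(** An intersection is no longer than either of its intervals, whose lengths are 2/p and 2/q. *)
Lemma ell_leV d p q : 0 < p -> 0 < q -> ell d p q <= 2 / p /\ ell d p q <= 2 / q.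
Proof.
move=> p0 q0; have ip : 0 < p^-1 by rewrite invr_gt0.
have iq : 0 < q^-1 by rewrite invr_gt0.
rewrite /ell.
split; rewrite ge_max mulr_ge0 ?(ltW ip) ?(ltW iq) //=.
  have h1 : Num.min ((d + 1) / p) q^-1 <= (d + 1) / p by rewrite ge_min lexx.
  have h2 : (d - 1) / p <= Num.max ((d - 1) / p) (- q^-1) by rewrite le_max lexx.
  lra.
have h1 : Num.min ((d + 1) / p) q^-1 <= q^-1 by rewrite ge_min lexx orbT.
have h2 : - q^-1 <= Num.max ((d - 1) / p) (- q^-1) by rewrite le_max lexx orbT.
lra.
Qed.

Lemma ell1r d t : 0 <= d -> 0 < t <= 1 ->
  ell d t 1 = Num.max 0 (1 - Num.max ((d - 1) / t) (-1)).
Proof.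
move=> d0 /andP[t0 t1]; rewrite /ell invr1; congr (Num.max 0 (_ - _)).
by apply/min_idPr; rewrite ler_pdivlMr //; lra.
Qed.

Lemma ell1l d t : 0 <= d <= 2 -> 0 < t <= 1 ->
  ell d 1 t = Num.min (d + 1) t^-1 - (d - 1).
Proof.
move=> d0 /andP[t0 t1]; rewrite /ell !divr1.
have it : 1 <= t^-1 by rewrite invf_ge1.
have -> : Num.max (d - 1) (- t^-1) = d - 1 by apply/max_idPl; lra.
by apply/max_idPr; rewrite subr_ge0 le_min; apply/andP; split; lra.
Qed.

(** By [ell1r], t enters only through (d - 1) / t, so the sign of d - 1 decides the direction:
    nonincreasing for d <= 1, nondecreasing for d > 1. *)
Lemma ell1r_monotone d : 0 <= d <= 2 -> bounded_monotone (fun t => ell d t 1).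
Proof.
move=> d02; split=> [t t01|].
  have [||_] := @ell_leV d t 1; rewrite ?ltr01 ?divr1 //; first by lra.
  by move=> h; rewrite ell_ge0.
have le_q x y : 0 < x -> x <= y -> y^-1 <= x^-1.
  by move=> x0 xy; rewrite lef_pV2 ?posrE //; lra.
case: (lerP d 1) => d1.
  exists (- 1); first by rewrite normrN1.
  move=> x y x0 xy y1; rewrite mulN1r ler0_norm // subr_le0 !ell1r; try lra.
  rewrite ge_max !le_max lexx /= ; apply/orP; right.
  rewrite lerD2l lerN2 ge_max !le_max lexx orbT andbT; apply/orP; left.
  by rewrite ler_wnM2l ?le_q //; lra.
exists 1; first by rewrite normr1.
move=> x y x0 xy y1; rewrite mul1r ger0_norm // subr_ge0 !ell1r; try lra.
rewrite ge_max !le_max lexx /= ; apply/orP; right.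
rewrite lerD2l lerN2 ge_max !le_max lexx orbT andbT; apply/orP; left.
by rewrite ler_wpM2l ?le_q //; lra.
Qed.

Lemma ell1l_monotone d : 0 <= d <= 2 -> bounded_monotone (fun t => ell d 1 t).
Proof.
move=> d02; split=> [t t01|].
  have [||h _] := @ell_leV d 1 t; rewrite ?ltr01 //; first by lra.
  by rewrite ell_ge0 -[2]divr1.
exists (- 1); first by rewrite normrN1.
move=> x y x0 xy y1; rewrite mulN1r ler0_norm // subr_le0 !ell1l; try lra.
rewrite lerD2r le_min !ge_min lexx /=; apply/orP; right.
by rewrite lef_pV2 ?posrE //; lra.
Qed.

(** The function h of the overview: by homogeneity, ell d p q * ell d q p is [profile d (p / q)]
    divided by q^2. *)
Definition profile d t := ell d t 1 * ell d 1 t.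

(** The shape of the profile changes at t = |1 - d| and at t = 1/(1 + d). This lemma and the next
    three treat the resulting ranges; here and in the next one the formula is laid out as in
    [has_int_log], including a zero coefficient. *)
Lemma profile_outer d t : 0 <= d <= 2 -> 0 < t <= 1 ->
  1 - d <= t -> d - 1 <= t -> 1 <= t * (d + 1) ->
  (1 - d) + (1 + (1 - d) ^+ 2) / t + (1 - d) / t ^+ 2 = profile d t.
Proof.
move=> d02 t01 h1 h2 h3; have t0 : 0 < t by lra.
rewrite /profile ell1r ?ell1l //; last by lra.
have -> : Num.min (d + 1) t^-1 = t^-1.
  by apply/min_idPr; rewrite -[t^-1]mul1r ler_pdivrMr // mulrC.
have -> : Num.max ((d - 1) / t) (-1) = (d - 1) / t.
  by apply/max_idPl; rewrite ler_pdivlMr //; lra.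
have -> : Num.max 0 (1 - (d - 1) / t) = 1 - (d - 1) / t.
  by apply/max_idPr; rewrite subr_ge0 ler_pdivrMr //; lra.
by field; rewrite gt_eqF.
Qed.

Lemma profile_middle d t : 0 <= d <= 2 -> 0 < t <= 1 ->
  1 - d <= t -> d - 1 <= t -> t * (d + 1) <= 1 ->
  2 + (2 * (1 - d)) / t + 0 / t ^+ 2 = profile d t.
Proof.
move=> d02 t01 h1 h2 h3; have t0 : 0 < t by lra.
rewrite /profile ell1r ?ell1l //; last by lra.
have -> : Num.min (d + 1) t^-1 = d + 1.
  by apply/min_idPl; rewrite -[t^-1]mul1r ler_pdivlMr // mulrC.
have -> : Num.max ((d - 1) / t) (-1) = (d - 1) / t.
  by apply/max_idPl; rewrite ler_pdivlMr //; lra.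
have -> : Num.max 0 (1 - (d - 1) / t) = 1 - (d - 1) / t.
  by apply/max_idPr; rewrite subr_ge0 ler_pdivrMr //; lra.
by field; rewrite gt_eqF.
Qed.

Lemma profile_inner d t : 0 <= d <= 1 -> 0 < t <= 1 -> t <= 1 - d ->
  4 = profile d t.
Proof.
move=> d02 t01 h1; have t0 : 0 < t by lra.
rewrite /profile ell1r ?ell1l //; try lra.
have -> : Num.min (d + 1) t^-1 = d + 1.
  apply/min_idPl; rewrite -[t^-1]mul1r ler_pdivlMr // mulrC.
  have : t * (d + 1) <= (1 - d) * (d + 1) by rewrite ler_wpM2r //; lra.
  have := sqr_ge0 d; lra.
have -> : Num.max ((d - 1) / t) (-1) = -1.
  by apply/max_idPr; rewrite ler_pdivrMr //; lra.
have -> : 1 - -1 = 2 :> R by ring.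
have -> : Num.max 0 2 = 2 :> R by apply/max_idPr.
by ring.
Qed.

(** The interval starting at (d - 1) / t begins at or beyond 1, where the other one ends. *)
Lemma profile_zero d t : 1 <= d <= 2 -> 0 < t <= 1 -> t <= d - 1 ->
  0 = profile d t.
Proof.
move=> d02 t01 h1; have t0 : 0 < t by lra.
rewrite /profile ell1r; try lra.
have h : 1 <= (d - 1) / t by rewrite ler_pdivlMr //; lra.
have -> : Num.max ((d - 1) / t) (-1) = (d - 1) / t by apply/max_idPl; lra.
have -> : Num.max 0 (1 - (d - 1) / t) = 0 by apply/max_idPl; lra.
by rewrite mul0r.
Qed.

(** The pieces are glued at the breakpoints. For d < 1 these are 1 - d <= c, with c = 1/(1 + d); for
    1 < d they are d - 1 and c, and d - 1 <= c exactly when d^2 <= 2. Beyond sqrt 2 the middle piece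
    disappears, which is why V has a separate formula there. *)
Lemma has_int_profile d : 0 <= d <= 2 -> has_int (profile d) 0 1 (V d).
Proof.
move=> d02.
have d10 : 0 < 1 + d by lra.
pose c := (1 + d)^-1.
have c0 : 0 < c by rewrite invr_gt0.
have c1 : c <= 1 by rewrite invf_le1 //; lra.
have ce : c * (1 + d) = 1 by rewrite mulVf // gt_eqF.
have lnc : ln c = - ln (1 + d) by rewrite lnV.
have outer a : 1 - d <= a -> d - 1 <= a -> 0 < a -> c <= a -> a <= 1 ->
    has_int (profile d) a 1 ((1 - d) * (1 - a) - (1 + (1 - d) ^+ 2) * ln a
      + (1 - d) * (a^-1 - 1)).
  move=> h1 h2 a0 ca a1; have := @has_int_log R (1 - d) (1 + (1 - d) ^+ 2) (1 - d) a 1 a0 a1.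
  rewrite ln1 sub0r mulrN invr1; apply: eq_has_int => t /andP[t1 t2].
  apply: profile_outer; try lra.
  by rewrite -[leLHS]ce [d + 1]addrC ler_pM2r //; lra.
have middle a : 1 - d <= a -> d - 1 <= a -> 0 < a -> a <= c ->
    has_int (profile d) a c (2 * (c - a) + 2 * (1 - d) * (ln c - ln a)).
  move=> h1 h2 a0 ca; have := @has_int_log R 2 (2 * (1 - d)) 0 a c a0 ca.
  rewrite mul0r addr0; apply: eq_has_int => t /andP[t1 t2].
  apply: profile_middle; try lra.
  by rewrite -[leRHS]ce [d + 1]addrC ler_pM2r //; lra.
have cV : c^-1 = 1 + d by rewrite invrK.
rewrite /V ger0_norm; last by lra.
case: ltP => d1.
  have dc : 1 - d <= c.
    rewrite -[c]mul1r ler_pdivlMr //; have := sqr_ge0 d; lra.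
  have I1 : has_int (profile d) 0 (1 - d) (4 * (1 - d - 0)).
    have := @has_int_cst R 4 0 (1 - d); apply: eq_has_int => t ht.
    by apply: profile_inner; lra.
  have I2 := middle (1 - d) ltac:(lra) ltac:(lra) ltac:(lra) dc.
  have I3 := outer c dc ltac:(lra) c0 ltac:(lra) c1.
  have d10' : 0 <= 1 - d by lra.
  have := has_int_cat (ltW c0) c1 (has_int_cat d10' dc I1 I2) I3.
  suff -> : 4 * (1 - d - 0) + (2 * (c - (1 - d)) + 2 * (1 - d) * (ln c - ln (1 - d)))
    + ((1 - d) * (1 - c) - (1 + (1 - d) ^+ 2) * ln c + (1 - d) * (c^-1 - 1))
    = 4 - 2 * d - d ^+ 2 + d ^+ 2 * ln (1 + d) - 2 * (1 - d) * ln (1 - d) by [].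
  rewrite lnc cV; clearbody c; move: (ln (1 + d)) (ln (1 - d)) => L L'; lra.
case: eqP => [dE|/eqP dN].
  have cE : c = 2^-1 by rewrite /c dE.
  (* At d = 1 the middle piece reaches down to 0, outside the scope of [has_int_log]; but its
     coefficient 2 (1 - d) of 1/t vanishes and the profile is the constant 2. *)
  have I1 : has_int (profile d) 0 c (2 * (c - 0)).
    have := @has_int_cst R 2 0 c; apply: eq_has_int => t ht.
    rewrite -(@profile_middle d); try lra.
      by rewrite dE subrr mulr0 !mul0r !addr0.
    by rewrite -[leRHS]ce [d + 1]addrC ler_pM2r //; lra.
  have I2 := outer c ltac:(lra) ltac:(lra) c0 ltac:(lra) c1.
  have := has_int_cat (ltW c0) c1 I1 I2.
  suff -> : 2 * (c - 0) + ((1 - d) * (1 - c) - (1 + (1 - d) ^+ 2) * ln c +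
     (1 - d) * (c^-1 - 1)) = 1 + ln 2 by [].
  rewrite lnc cV cE dE.
  have -> : 1 + 1 = 2 :> R by ring.
  by move: (ln 2) => L; field.
have {d1 dN} d1 : 1 < d by rewrite lt_neqAle eq_sym dN.
have d10' : 0 <= d - 1 by lra.
have I0 : has_int (profile d) 0 (d - 1) (0 * (d - 1 - 0)).
  have := @has_int_cst R 0 0 (d - 1); apply: eq_has_int => t ht.
  by apply: profile_zero; lra.
have sq2 : (d <= Num.sqrt 2) = (d ^+ 2 <= 2).
  by rewrite -[d in LHS]ger0_norm -?sqrtr_sqr ?ler_sqrt //; lra.
case: ifPn; rewrite sq2; last rewrite -ltNge; move=> d2.
  have dc : d - 1 <= c by rewrite -[c]mul1r ler_pdivlMr //; lra.
  have I2 := middle (d - 1) ltac:(lra) ltac:(lra) ltac:(lra) dc.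
  have I3 := outer c ltac:(lra) dc c0 ltac:(lra) c1.
  have := has_int_cat (ltW c0) c1 (has_int_cat d10' dc I0 I2) I3.
  suff -> : 0 * (d - 1 - 0) + (2 * (c - (d - 1)) + 2 * (1 - d) * (ln c - ln (d - 1)))
    + ((1 - d) * (1 - c) - (1 + (1 - d) ^+ 2) * ln c + (1 - d) * (c^-1 - 1))
    = 4 - 2 * d - d ^+ 2 + d ^+ 2 * ln (d + 1) + 2 * (d - 1) * ln (d - 1) by [].
  rewrite lnc cV [d + 1]addrC.
  by clearbody c; move: (ln (1 + d)) (ln (d - 1)) => L L'; lra.
have cd : c <= d - 1 by rewrite -[c]mul1r ler_pdivrMr //; lra.
have I1 := outer (d - 1) ltac:(lra) ltac:(lra) ltac:(lra) cd ltac:(lra).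
have d1' : d - 1 <= 1 by lra.
have := has_int_cat d10' d1' I0 I1.
suff -> : 0 * (d - 1 - 0) + ((1 - d) * (1 - (d - 1)) - (1 + (1 - d) ^+ 2) * ln (d - 1)
    + (1 - d) * ((d - 1)^-1 - 1))
    = d ^+ 2 - 2 * d - (d ^+ 2 - 2 * d + 2) * ln (d - 1) by [].
have : (d - 1)^-1 * (d - 1) = 1 by rewrite mulVf // gt_eqF //; lra.
by move: (_^-1) (ln _) => e L h; lra.
Qed.

(** V d is the integral over [0, 1] of a product of two factors with values in [0, 2]. *)
Lemma V_bound d : 0 <= d <= 2 -> 0 <= V d <= 4.
Proof.
move=> d02; have [H h <-] := has_int_profile d02.
have := h 0 1 0 4 (lexx 0) ler01 (lexx 1).
rewrite subr0 mul0r mulr1; apply=> t t01.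
have t01' : 0 < t <= 1 by lra.
have := (ell1r_monotone d02).1 t t01'; have := (ell1l_monotone d02).1 t t01'.
move=> /andP[a1 a2] /andP[a3 a4]; rewrite mulr_ge0 //=.
have -> : 4 = 2 * 2 :> R by ring.
exact: ler_pM.
Qed.

End Density.

(** * Sums over coprime pairs *)

Section Coprime.
Variable R : realType.

Lemma sum_dvdn (G : nat -> R) d n : (0 < d)%N ->
  \sum_(1 <= q < n.+1 | (d %| q)%N) G (q %/ d)%N =
  \sum_(1 <= m < (n %/ d).+1) G m.
Proof.
move=> d0; elim: n => [|n IH]; first by rewrite div0n !big_geq.
rewrite big_mkcond big_nat_recr //= -big_mkcond IH divnS //.
case: ifPn => dn; last by rewrite addr0.
by rewrite /= !add1n dn [RHS]big_nat_recr.
Qed.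

(** Each pair is d times a coprime pair, with d its gcd, and homogeneity of degree -2 extracts
    1/d^2. The proof inserts the indicator of d = gcd and exchanges the sums. *)
Lemma sum_by_gcd (F : nat -> nat -> R) n :
  (forall d p q, (0 < d)%N -> F (d * p)%N (d * q)%N = F p q / d%:R ^+ 2) ->
  \sum_(1 <= q < n.+1) \sum_(1 <= p < q.+1) F p q =
  \sum_(1 <= d < n.+1)
    (\sum_(1 <= q < (n %/ d).+1) \sum_(1 <= p < q.+1 | coprime p q) F p q)
      / d%:R ^+ 2.
Proof.
move=> FM.
transitivity (\sum_(1 <= q < n.+1) \sum_(1 <= p < q.+1)
    \sum_(1 <= d < n.+1) if d == gcdn p q then F p q else 0).
  apply: eq_big_nat => q /andP[q1 q2]; apply: eq_big_nat => p /andP[p1 p2].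
  have g0 : (0 < gcdn p q)%N by rewrite gcdn_gt0 p1.
  have gn : (gcdn p q < n.+1)%N.
    by apply: leq_ltn_trans q2; rewrite dvdn_leq // dvdn_gcdr.
  rewrite (bigD1_seq (gcdn p q)) ?mem_index_iota ?g0 ?iota_uniq //=.
  by rewrite eqxx big1 ?addr0 // => i /negbTE ->.
under eq_bigr do rewrite exchange_big /=.
rewrite exchange_big /=; apply: eq_big_nat => d /andP[d0 dn].
pose G q := (\sum_(1 <= p < q.+1 | coprime p q) F p q) / d%:R ^+ 2.
rewrite mulr_suml -(@sum_dvdn G d n d0) [RHS]big_mkcond /=.
apply: eq_big_nat => q /andP[q1 q2]; rewrite /G mulr_suml.
case: ifPn => dq; last first.
  rewrite big1 // => p _; case: eqP => // dE.
  by move: dq; rewrite dE dvdn_gcdr.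
pose G' p := if coprime p (q %/ d) then F p (q %/ d)%N / d%:R ^+ 2 else 0.
rewrite [RHS]big_mkcond /= -(@sum_dvdn G' d q d0) [RHS]big_mkcond /=.
apply: eq_big_nat => p /andP[p1 p2].
case: (boolP (d %| p)%N) => dp; last first.
  by rewrite ifN //; apply: contra dp => /eqP ->; exact: dvdn_gcdl.
have [p' pE] := dvdnP dp; have [q' qE] := dvdnP dq.
rewrite /G' pE qE !mulnK // -muln_gcdl -{1}[d]mul1n eqn_pmul2r // eq_sym.
rewrite /coprime; case: ifP => // _.
by rewrite mulnC [(q' * d)%N]mulnC FM.
Qed.

Lemma ln_divn n d : (0 < d <= n)%N ->
  0 <= (ln n%:R - ln (n %/ d)%:R : R) <= ln d%:R + 1.
Proof.
move=> /andP[d0 dn].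
have nd0 : (0 < n %/ d)%N by rewrite divn_gt0.
have n0 : (0 < n)%N by exact: leq_trans dn.
have l2 : ln 2 <= 1 :> R.
  by have := @le_ln1Dx R 1; apply; lra.
rewrite subr_ge0 ler_ln ?posrE ?ltr0n // ler_nat leq_div /=.
(* As n / d < floor(n / d) + 1 <= 2 floor(n / d), rounding down loses at most a factor 2, and ln 2
   <= 1. *)
suff : ln n%:R <= ln (d%:R * (n %/ d)%:R * 2) :> R.
  by rewrite !lnM ?posrE ?mulr_gt0 ?ltr0n //; lra.
rewrite ler_ln ?posrE ?mulr_gt0 ?ltr0n // -!natrM ler_nat.
by have := divn_eq n d; have := ltn_pmod n d0; nia.
Qed.

(* The coefficients of S (n %/ d) for d >= 2 sum to at most 3/4, so the error term
   of S is bounded by strong induction, without Moebius inversion. *)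
Lemma renewal (T S : nat -> R) (v C : R) : `|v| <= 4 -> 0 <= C ->
  (forall n, (0 < n)%N -> `|T n - v * ln n%:R| <= C) ->
  (forall n, (0 < n)%N ->
     T n = \sum_(1 <= d < n.+1) S (n %/ d)%N / d%:R ^+ 2) ->
  forall n, (0 < n)%N ->
    `|S n - 6 * v / pi ^+ 2 * ln n%:R| <= 4 * (C + 216).
Proof.
move=> v4 C0 TC TS; pose c := 6 * v / pi ^+ 2.
have p2 : 4 <= pi ^+ 2 :> R.
  by have := pi_ge2 R; move: (pi : R) => P hP; rewrite expr2; nra.
have p0 : 0 < pi ^+ 2 :> R by lra.
have c6 : `|c| <= 6.
  rewrite /c normrM normrM normfV [ `|6| ]ger0_norm // [ `|pi ^+ 2| ]gtr0_norm //.
  by rewrite ler_pdivrMr //; lra.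
have cv : c * (pi ^+ 2 / 6) = v.
  by rewrite /c; move: (pi ^+ 2 : R) p0 => P P0; field; rewrite gt_eqF.
rewrite -/c; clearbody c; elim/ltn_ind => n IH n0.
have n0' : 0 < n%:R :> R by rewrite ltr0n.
have sqV : \sum_(2 <= d < n.+1) (d%:R ^+ 2)^-1 <= 3 / 4 :> R by exact: sum_sqV_le.
have split1 (u : nat -> R) :
    \sum_(1 <= d < n.+1) u d = u 1%N + \sum_(2 <= d < n.+1) u d.
  by rewrite big_ltn.
have lnn : 0 <= (ln n%:R : R) <= n%:R.
  by rewrite ln_ge0 ?ler1n //= ltW // ln_sublinear.
(* The candidate c ln n nearly satisfies the same recursion. Here 216 = 6 * (32 + 4), where 6 bounds
   |c|; 32 comes from [basel] and ln n <= n, and 4 bounds the sum of (ln d + 1) / d^2. *)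
have e1 : `|v * ln n%:R - c * \sum_(1 <= d < n.+1) ln (n %/ d)%:R / d%:R ^+ 2| <= 216.
  have -> : v * ln n%:R - c * \sum_(1 <= d < n.+1) ln (n %/ d)%:R / d%:R ^+ 2 =
    c * ((pi ^+ 2 / 6 - \sum_(1 <= d < n.+1) (d%:R ^+ 2)^-1) * ln n%:R +
      \sum_(1 <= d < n.+1) (ln n%:R - ln (n %/ d)%:R) / d%:R ^+ 2).
    have -> : \sum_(1 <= d < n.+1) (ln n%:R - ln (n %/ d)%:R) / d%:R ^+ 2 =
       ln n%:R * \sum_(1 <= d < n.+1) (d%:R ^+ 2)^-1
       - \sum_(1 <= d < n.+1) ln (n %/ d)%:R / d%:R ^+ 2 :> R.
      by rewrite mulr_sumr -sumrB; apply: eq_bigr => d _; rewrite mulrBl.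
    rewrite -{1}cv.
    by move: (pi ^+ 2 / 6) (ln _) (bigop _ _ _) (bigop _ _ _) => x y z t; ring.
  have /andP[b1 b2] := @basel R n n0.
  move: (bigop _ _ _) b1 b2 => B b1 b2.
  have : 0 <= (pi ^+ 2 / 6 - B) * ln n%:R <= 32.
    have a0 : 0 <= pi ^+ 2 / 6 - B by rewrite subr_ge0.
    have a1 : pi ^+ 2 / 6 - B <= 32 / n%:R by rewrite lerBlDr -lerBlDl.
    rewrite mulr_ge0 //=; last by case/andP: lnn.
    have -> : 32 = 32 / n%:R * n%:R :> R by rewrite divfK // gt_eqF.
    by apply: ler_pM => //; case/andP: lnn.
  have : 0 <= \sum_(1 <= d < n.+1) (ln n%:R - ln (n %/ d)%:R : R) / d%:R ^+ 2 <= 4.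
    apply/andP; split.
      rewrite big_nat; apply: sumr_ge0 => d /andP[d1 d2].
      have /andP[h _] := @ln_divn n d ltac:(by rewrite d1).
      by rewrite divr_ge0 ?exprn_ge0.
    apply: le_trans (_ : \sum_(1 <= d < n.+1)
      (ln d%:R / d%:R ^+ 2 + (d%:R ^+ 2)^-1) <= _).
      rewrite big_nat [leRHS]big_nat; apply: ler_sum => d /andP[d1 d2].
      have /andP[_ h] := @ln_divn n d ltac:(by rewrite d1).
      rewrite -[X in _ <= _ + X]mul1r -mulrDl ler_pM2r //.
      by rewrite invr_gt0 exprn_gt0 // ltr0n.
    rewrite big_split /= [X in _ + X]split1 expr1n invr1.
    by have := @sum_ln_sqV_le R n; lra.
  move: (_ * ln _) (bigop _ _ _) => x y hy hx.
  have -> : 216 = 6 * 36 :> R by ring.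
  rewrite normrM ler_pM //.
  by rewrite ler_norml; lra.
(* The induction hypothesis 4 (C + 216) is multiplied by at most 3/4. Adding the errors C and 216
   restores 4 (C + 216), which explains the factor 4 in the conclusion. *)
have e2 : `|\sum_(2 <= d < n.+1) (S (n %/ d)%N - c * ln (n %/ d)%:R) / d%:R ^+ 2|
    <= 3 * (C + 216).
  apply: le_trans (ler_norm_sum _ _ _) _.
  apply: le_trans (_ : \sum_(2 <= d < n.+1) (4 * (C + 216)) * (d%:R ^+ 2)^-1 <= _).
    rewrite big_nat [leRHS]big_nat; apply: ler_sum => d /andP[d1 d2].
    rewrite normrM [ `|(d%:R ^+ 2)^-1| ]ger0_norm ?invr_ge0 ?exprn_ge0 //.
    rewrite ler_wpM2r ?invr_ge0 ?exprn_ge0 // IH //.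
      by rewrite ltn_Pdiv.
    by rewrite divn_gt0 // (leq_trans _ d1).
  rewrite -mulr_sumr; move: (bigop _ _ _) sqV => B sqV.
  have : 4 * (C + 216) * B <= 4 * (C + 216) * (3 / 4) by rewrite ler_wpM2l //; lra.
  lra.
have E : S n - c * ln n%:R = (T n - v * ln n%:R) +
   (v * ln n%:R - c * \sum_(1 <= d < n.+1) ln (n %/ d)%:R / d%:R ^+ 2)
   - \sum_(2 <= d < n.+1) (S (n %/ d)%N - c * ln (n %/ d)%:R) / d%:R ^+ 2.
  rewrite TS // !split1 divn1 expr1n !divr1.
  have -> : \sum_(2 <= d < n.+1) (S (n %/ d)%N - c * ln (n %/ d)%:R) / d%:R ^+ 2 =
     \sum_(2 <= d < n.+1) S (n %/ d)%N / d%:R ^+ 2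
     - c * \sum_(2 <= d < n.+1) ln (n %/ d)%:R / d%:R ^+ 2.
    by rewrite mulr_sumr -sumrB; apply: eq_bigr => d _; rewrite mulrBl -mulrA.
  by move: (ln _) (S n) (bigop _ _ _) (bigop _ _ _) => x y z t; ring.
rewrite E; apply: le_trans (ler_normB _ _) _.
by apply: le_trans (lerD (le_trans (ler_normD _ _) (lerD (TC n n0) e1)) e2) _; lra.
Qed.

(** [renewal] applies to the sum over all pairs: by homogeneity its row q is 1/q^2 times a Riemann
    sum of the profile with mesh 1/q, hence V d / q up to 12 / q^2. *)
Lemma coprime_sum_profile (d : R) n : 0 <= d <= 2 -> (0 < n)%N ->
  `|\sum_(1 <= q < n.+1) \sum_(1 <= p < q.+1 | coprime p q)
       ell d p%:R q%:R * ell d q%:R p%:R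
    - 6 * V d / pi ^+ 2 * ln n%:R| <= 976.
Proof.
move=> d02 n0; have V4 := V_bound d02.
pose F p q := ell d p%:R q%:R * ell d q%:R p%:R.
pose T m := \sum_(1 <= q < m.+1) \sum_(1 <= p < q.+1) F p q.
have := @renewal T (fun m => \sum_(1 <= q < m.+1) \sum_(1 <= p < q.+1 | coprime p q)
   F p q) (V d) 28.
have -> : 4 * (28 + 216) = 976 :> R by ring.
apply => //.
- by rewrite ger0_norm; lra.
- move=> m m0; rewrite /T.
  have bq q : (0 < q)%N ->
    `|\sum_(1 <= p < q.+1) F p q - V d * q%:R^-1| <= 12 * (q%:R ^+ 2)^-1.
    move=> q0; have q0' : 0 < q%:R :> R by rewrite ltr0n.
    have := @riemann_sum R _ _ _ q (ell1r_monotone d02) (ell1l_monotone d02)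
       (has_int_profile d02) q0.
    have -> : \sum_(1 <= p < q.+1) F p q = (\sum_(1 <= p < q.+1)
        ell d (p%:R / q%:R) 1 * ell d 1 (p%:R / q%:R)) * (q%:R ^+ 2)^-1.
      rewrite mulr_suml; apply: eq_big_nat => p /andP[p1 p2].
      have qp : q%:R * (p%:R / q%:R) = p%:R :> R.
        by rewrite mulrCA divff ?mulr1 // gt_eqF.
      have E1 := ell_scale d (p%:R / q%:R) 1 q0'.
      have E2 := ell_scale d 1 (p%:R / q%:R) q0'.
      rewrite /F; move: E1 E2; rewrite qp mulr1 => -> ->.
      by rewrite expr2 invfM mulrACA.
    move=> h.
    have -> : V d * q%:R^-1 = q%:R * V d * (q%:R ^+ 2)^-1.
      by field; rewrite gt_eqF.
    rewrite -mulrBl normrM [ `|(q%:R ^+ 2)^-1| ]ger0_norm ?invr_ge0 ?exprn_ge0 //.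
    by rewrite ler_pM2r // invr_gt0 exprn_gt0.
  have -> : \sum_(1 <= q < m.+1) \sum_(1 <= p < q.+1) F p q - V d * ln m%:R =
    \sum_(1 <= q < m.+1) (\sum_(1 <= p < q.+1) F p q - V d * q%:R^-1) +
    V d * (\sum_(1 <= q < m.+1) q%:R^-1 - ln m%:R).
    by rewrite sumrB -mulr_sumr; ring.
  (* The row errors 12 / q^2 sum to at most 12 * 2. Replacing the harmonic sum by the logarithm
     costs at most 1, weighted by V d <= 4. *)
  have -> : 28 = 12 * (1 + 1) + 4 * 1 :> R by ring.
  apply: le_trans (ler_normD _ _) _; apply: lerD.
    apply: le_trans (ler_norm_sum _ _ _) _.
    apply: le_trans (_ : \sum_(1 <= q < m.+1) 12 * (q%:R ^+ 2)^-1 <= _).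
      rewrite big_nat [leRHS]big_nat; apply: ler_sum => q /andP[q1 q2].
      exact: bq.
    rewrite -mulr_sumr ler_pM2l // big_ltn // expr1n invr1 lerD2l.
    by have := @sum_sqV_le R m; lra.
  rewrite normrM ler_pM //; first by rewrite ger0_norm; lra.
  by have := @harmonic_ln R m m0; rewrite ler_norml; lra.
- move=> m m0; apply: sum_by_gcd => c p q c0.
  have c0' : 0 < c%:R :> R by rewrite ltr0n.
  by rewrite /F !natrM !ell_scale // expr2 invfM mulrACA.
Qed.

End Coprime.

(** * Counting solutions of x y = b c *)

Section Counting.

Lemma count_image (T T' : eqType) (f : T -> T') (s : seq T) (t : seq T')
    (a : pred T) (a' : pred T') : uniq s -> uniq t ->
  (forall x y, a x -> a y -> f x = f y -> x = y) ->
  (forall y, reflect (exists2 x, (x \in s) && a x & y = f x) ((y \in t) && a' y)) ->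
  count a s = count a' t.
Proof.
move=> us ut fI h; rewrite -!size_filter -(size_map f).
apply: perm_size; apply: uniq_perm; last 1 first.
- move=> y; rewrite mem_filter andbC; apply/mapP/h => -[x].
    by rewrite mem_filter => /andP[ax xs] ->; exists x; rewrite ?xs.
  by move=> /andP[xs ax] ->; exists x; rewrite // mem_filter ax.
- rewrite map_inj_in_uniq ?filter_uniq // => x y.
  by rewrite !mem_filter => /andP[ax _] /andP[ay _]; exact: fI.
- exact: filter_uniq.
Qed.

Lemma sum_nat_of_bool (T : Type) (s : seq T) (a : pred T) :
  (\sum_(x <- s) (a x : nat))%N = count a s.
Proof. by rewrite -sum1_count [RHS]big_mkcond. Qed.

Lemma sum_nat_of_bool2 (S T : Type) (s : seq S) (t : seq T) (a : pred S)
    (b : pred T) (c : S -> T -> bool) :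
  (\sum_(x <- s | a x) \sum_(y <- t | b y) (c x y : nat))%N =
  count (fun u => [&& a u.1, b u.2 & c u.1 u.2]) [seq (x, y) | x <- s, y <- t].
Proof.
rewrite -sum_nat_of_bool big_allpairs [LHS]big_mkcond; apply: eq_bigr => x _ /=.
case: (a x) => /=; last by rewrite big1.
by rewrite [LHS]big_mkcond; apply: eq_bigr => y _ /=; case: (b y).
Qed.

Definition zseq (n : nat) : seq int := [seq i%:Z - n%:Z | i <- iota 0 n.*2.+1].

Lemma mem_zseq n z : (z \in zseq n) = (`|z| <= n%:Z).
Proof.
apply/mapP/idP => [[i]|zn].
  by rewrite mem_iota => hi ->; lia.
by exists (absz (z + n%:Z)); rewrite ?mem_iota; lia.
Qed.

Lemma uniq_zseq n : uniq (zseq n).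
Proof. by rewrite map_inj_uniq ?iota_uniq // => i j; lia. Qed.

Lemma count_zseq_itv n (a b : int) :
  (forall g, a <= g <= b -> `|g| <= n%:Z) ->
  (count (fun g => a <= g <= b) (zseq n))%:Z = if a <= b then b - a + 1 else 0.
Proof.
move=> h; case: ifPn => ab; last first.
  suff -> : count (fun g => a <= g <= b) (zseq n) = 0%N by [].
  apply/eqP; rewrite -leqn0 leqNgt -has_count; apply/hasPn => g _; lia.
rewrite -(@count_image _ _ (fun i : nat => a + i%:Z)
  (iota 0 (absz (b - a)).+1) _ xpredT) ?uniq_zseq ?iota_uniq //.
- by rewrite count_predT size_iota; lia.
- by move=> x y _ _; lia.
- move=> y; rewrite mem_zseq; apply: (iffP andP) => [[_ /andP[ay yb]]|[x]].
    by exists (absz (y - a)); rewrite ?mem_iota; lia.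
  rewrite mem_iota andbT => /andP[_ hx] ->.
  have hab : a <= a + x%:Z <= b by lia.
  by split; first exact: h.
Qed.

Lemma count_zseq_ball (n : nat) (c : int) (k : nat) :
  (count (fun g => (`|c - g| <= k%:Z)%R) (zseq n) <= k.*2.+1)%N.
Proof.
rewrite -size_filter.
apply: leq_trans (_ : size [seq (c - i)%R | i <- zseq k] <= _)%N; last first.
  by rewrite !size_map size_iota.
apply: uniq_leq_size; first by rewrite filter_uniq ?uniq_zseq.
move=> g; rewrite mem_filter => /andP[h _]; apply/mapP; exists (c - g).
  by rewrite mem_zseq.
by lia.
Qed.

(** Uniqueness of lowest terms: once the gcd is cancelled, Gauss's lemma gives divisibility in both
    directions. *)
Lemma coprime_ratio (X Y p q : nat) : (0 < X)%N -> (0 < Y)%N -> coprime p q ->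
  (X * q == p * Y)%N = (p == X %/ gcdn X Y)%N && (q == Y %/ gcdn X Y)%N.
Proof.
move=> X0 Y0 pq; set g := gcdn X Y.
have g0 : (0 < g)%N by rewrite gcdn_gt0 X0.
have [X' XE] := dvdnP (dvdn_gcdl X Y); have [Y' YE] := dvdnP (dvdn_gcdr X Y).
rewrite -/g in XE YE.
have cXY : coprime X' Y'.
  have : gcdn X Y = (gcdn X' Y' * g)%N by rewrite {1}XE {1}YE muln_gcdl.
  rewrite -/g -{1}[g]mul1n => /eqP; rewrite eqn_pmul2r // eq_sym => h; exact: h.
rewrite XE YE !mulnK //.
have -> : (X' * g * q == p * (Y' * g))%N = (X' * q == p * Y')%N.
  by rewrite mulnAC mulnA eqn_pmul2r.
apply/eqP/andP => [e|[/eqP -> /eqP ->]]; last by rewrite mulnC [RHS]mulnC mulnC.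
have X'0 : (0 < X')%N by move: X0; rewrite XE muln_gt0 => /andP[].
have pX : p = X'.
  apply/eqP; rewrite eqn_dvd; apply/andP; split.
    by rewrite -(Gauss_dvdl X' pq) e dvdn_mulr.
  by rewrite -(Gauss_dvdl p cXY) -e dvdn_mulr.
split; first by rewrite pX.
by rewrite -(eqn_pmul2l X'0) e pX.
Qed.

Lemma signed_ratio (x b : int) (s : bool) (p q : nat) : x != 0 -> b != 0 ->
  coprime p q -> (0 < p)%N -> (0 < q)%N ->
  (x * q%:Z == (-1) ^+ s * p%:Z * b) =
  [&& s == (x < 0) (+) (b < 0), p == (`|x| %/ gcdn `|x| `|b|)%N
    & q == (`|b| %/ gcdn `|x| `|b|)%N].
Proof.
move=> x0 b0 pq p0 q0; rewrite -coprime_ratio ?absz_gt0 //.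
have e1 : x = (-1) ^+ (x < 0)%R * `|x|%N%:Z by rewrite -intEsign.
have e2 : b = (-1) ^+ (b < 0)%R * `|b|%N%:Z by rewrite -intEsign.
have X0 : (0 < `|x|)%N by rewrite absz_gt0.
have B0 : (0 < `|b|)%N by rewrite absz_gt0.
rewrite {1}e1 {1}e2; move: (x < 0) (b < 0) `|x|%N `|b|%N X0 B0.
move=> sx sb X B X0 B0; have XQ : (0 < X * q)%N by rewrite muln_gt0 X0.
have PB : (0 < p * B)%N by rewrite muln_gt0 p0.
case: s; case: sx; case: sb; rewrite /= ?expr0 ?expr1; lia.
Qed.

(** Exactly one sign and one coprime pair represent the ratio x : b. Inserting this sum of
    indicators into a count sorts it by that ratio. *)
Lemma sum_signed_ratio n (x b : int) : x != 0 -> b != 0 ->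
  `|x| <= n%:Z -> `|b| <= n%:Z ->
  (\sum_(s : bool) \sum_(1 <= p < n.+1) \sum_(1 <= q < n.+1 | coprime p q)
     (x * q%:Z == (-1) ^+ s * p%:Z * b)%R)%N = 1%N.
Proof.
move=> x0 b0 xn bn.
set s0 := (x < 0) (+) (b < 0).
set p0 := (`|x| %/ gcdn `|x| `|b|)%N; set q0 := (`|b| %/ gcdn `|x| `|b|)%N.
have X0 : (0 < `|x|)%N by rewrite absz_gt0.
have B0 : (0 < `|b|)%N by rewrite absz_gt0.
have g0 : (0 < gcdn `|x| `|b|)%N by rewrite gcdn_gt0 X0.
have p00 : (0 < p0)%N by rewrite divn_gt0 // dvdn_leq // dvdn_gcdl.
have q00 : (0 < q0)%N by rewrite divn_gt0 // dvdn_leq // dvdn_gcdr.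
have p0n : (p0 < n.+1)%N by apply: leq_ltn_trans (leq_div _ _) _; lia.
have q0n : (q0 < n.+1)%N by apply: leq_ltn_trans (leq_div _ _) _; lia.
have cpq : coprime p0 q0.
  by rewrite /coprime -(eqn_pmul2r g0) muln_gcdl !divnK ?dvdn_gcdl ?dvdn_gcdr // mul1n.
have term (s : bool) p : (0 < p)%N -> (\sum_(1 <= q < n.+1 | coprime p q)
     (x * q%:Z == (-1) ^+ s * p%:Z * b)%R)%N = ((s == s0) && (p == p0) : nat).
  move=> hp; rewrite big_nat_cond.
  under eq_bigr => q /andP[/andP[q1 _] pq] do rewrite signed_ratio //.
  rewrite -/s0 -/p0 -/q0 -big_nat_cond.
  case: (s == s0) => /=; last by rewrite big1.
  case: eqP => [->|_] /=; last by rewrite big1.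
  rewrite (big_rem q0) ?mem_index_iota ?q00 //= cpq eqxx big_seq_cond big1 // => q.
  rewrite mem_rem_uniq ?iota_uniq // inE => /andP[/andP[/negbTE -> _] _]; by [].
rewrite (bigD1 s0) //= [X in (_ + X)%N]big1 ?addn0; last first.
  move=> s /negbTE hs; rewrite big_nat big1 // => p /andP[p1 _].
  by rewrite term // hs.
rewrite big_nat; under eq_bigr => p /andP[p1 _] do rewrite term // eqxx.
rewrite -big_nat (bigD1_seq p0) ?mem_index_iota ?p00 ?iota_uniq //= eqxx big1 //.
by move=> p /negbTE ->.
Qed.

(** * Quadruples (x, b, y, c) for fixed k and l *)

Section Fixed.
Variables (k : nat) (l : int).
(** When |l| <= 2 k, all x with |l - x| <= k satisfy |x| <= 3 k, so the box [J] contains every value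
    that matters. *)
Let n := (3 * k)%N.
Let J := zseq n.
Let I (x : int) := `|l - x| <= k%:Z.
Let B (b : int) := `|b| <= k%:Z.

(** The G(p,q) of the overview: the nonzero g for which (g p, g q) is an admissible pair (x, b). *)
Definition multiples (p q : nat) : nat :=
  count (fun g => [&& g != 0, `|l - g * p%:Z| <= k%:Z & `|g * q%:Z| <= k%:Z]) J.

Lemma multiples_eq0 p q : (k < q)%N -> multiples p q = 0%N.
Proof.
move=> kq; apply/eqP; rewrite -leqn0 leqNgt -has_count; apply/hasPn => g _.
apply/negP => /and3P[g0 _]; rewrite normrM [ `|q%:Z| ]ger0_norm // => h.
have g1 : 1 <= `|g| by lia.
have : 1 * q%:Z <= `|g| * q%:Z by rewrite ler_wpM2r.
by move: h; rewrite mul1r; move: (`|g| * _) => z; lia.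
Qed.

(** A sum over the matrices [[l - x, b], [c, l - y]] with entries bounded by k. *)
Definition quad (F : int -> int -> int -> int -> nat) : nat :=
  (\sum_(x <- J | I x) \sum_(b <- J | B b) \sum_(y <- J | I y) \sum_(c <- J | B c)
    F x b y c)%N.

Lemma quad_le F G : (forall x b y c, I x -> B b -> I y -> B c -> F x b y c <= G x b y c)%N ->
  (quad F <= quad G)%N.
Proof.
move=> h; apply: leq_sum => x Ix; apply: leq_sum => b Bb.
by apply: leq_sum => y Iy; apply: leq_sum => c Bc; apply: h.
Qed.

Lemma quadD F G : quad (fun x b y c => F x b y c + G x b y c)%N = (quad F + quad G)%N.
Proof.
rewrite /quad -big_split; apply: eq_bigr => x _; rewrite -big_split.
apply: eq_bigr => b _; rewrite -big_split; apply: eq_bigr => y _.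
exact: big_split.
Qed.

Lemma quad_prod (f g h e : int -> nat) :
  quad (fun x b y c => (f x * g b) * (h y * e c))%N =
  ((\sum_(x <- J | I x) f x) * (\sum_(b <- J | B b) g b) *
   ((\sum_(y <- J | I y) h y) * (\sum_(c <- J | B c) e c)))%N.
Proof.
rewrite big_distrlr big_distrlr big_distrl /=; apply: eq_bigr => x _.
rewrite big_distrl; apply: eq_bigr => b _ /=.
rewrite big_distrr; apply: eq_bigr => y _ /=.
by rewrite big_distrr.
Qed.

Lemma sum_ball1 c : (\sum_(x <- J | (`|c - x| <= k%:Z)%R) 1 <= k.*2.+1)%N.
Proof. by rewrite sum1_count count_zseq_ball. Qed.

Lemma sum_eq0_le1 (P : pred int) : (\sum_(x <- J | P x) (x == 0) <= 1)%N.
Proof.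
rewrite big_mkcond; apply: leq_trans (_ : \sum_(x <- J) (x == 0) <= _)%N.
  by apply: leq_sum => x _; case: (P x).
by rewrite sum_nat_of_bool count_uniq_mem ?uniq_zseq // leq_b1.
Qed.

(** If x y = b c has a zero entry, then one of x, y and one of b, c vanish. Each of the four choices
    leaves two entries free, with at most 2 k + 1 values each. *)
Lemma quad_zero_le :
  (quad (fun x b y c => x * y == b * c)%R <=
   quad (fun x b y c => [&& x != 0, b != 0, y != 0, c != 0 & x * y == b * c])%R
   + 4 * k.*2.+1 ^ 2)%N.
Proof.
(* Opaque names for the indicator of 0 and for the constant 1 give each of the four cases the
   product form of [quad_prod]. *)
have [z zE] : {z : int -> nat | forall x, z x = (x == 0)} by exists (fun x => x == 0).
have [one oneE] : {one : int -> nat | forall x, one x = 1%N} by exists (fun=> 1%N).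
have sI : (\sum_(x <- J | I x) one x <= k.*2.+1)%N.
  by rewrite (eq_bigr (fun=> 1%N)) // sum_ball1.
have sB : (\sum_(x <- J | B x) one x <= k.*2.+1)%N.
  rewrite (eq_bigr (fun=> 1%N)) //; apply: leq_trans (sum_ball1 0).
  rewrite leq_eqVlt; apply/orP; left.
  by apply/eqP/eq_bigl => x; rewrite /B sub0r normrN.
have zI : (\sum_(x <- J | I x) z x <= 1)%N.
  by rewrite (eq_bigr (fun x => x == 0 : nat)) // sum_eq0_le1.
have zB : (\sum_(x <- J | B x) z x <= 1)%N.
  by rewrite (eq_bigr (fun x => x == 0 : nat)) // sum_eq0_le1.
apply: leq_trans (_ : quad (fun x b y c =>
  [&& x != 0, b != 0, y != 0, c != 0 & x * y == b * c]%R +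
  (((z x * z b) * (one y * one c) + (z x * one b) * (one y * z c)) +
   ((one x * z b) * (z y * one c) + (one x * one b) * (z y * z c))))%N <= _)%N.
  apply: quad_le => x b y c _ _ _ _; rewrite !zE !oneE.
  case: eqP => // e.
  have : (x == 0) || (y == 0) = (b == 0) || (c == 0) by rewrite -!mulf_eq0 e.
  by case: (x == 0); case: (y == 0); case: (b == 0); case: (c == 0).
rewrite !quadD !quad_prod leq_add2l.
have -> : (4 * k.*2.+1 ^ 2 = 1 * 1 * (k.*2.+1 * k.*2.+1) + 1 * k.*2.+1 * (k.*2.+1 * 1)
   + (k.*2.+1 * 1 * (1 * k.*2.+1) + k.*2.+1 * k.*2.+1 * (1 * 1)))%N by lia.
by apply: leq_add; apply: leq_add; apply: leq_mul; apply: leq_mul.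
Qed.

Hypothesis l2k : `|l| <= 2 * k%:Z.

(* If x : b = (-1)^s p : q with p, q coprime, then (x, b) = g (p, (-1)^s q). *)
Lemma signed_pairs (s : bool) p q : (0 < p)%N -> (0 < q)%N -> coprime p q ->
  (\sum_(x <- J | I x) \sum_(b <- J | B b)
     [&& x != 0, b != 0 & x * q%:Z == (-1) ^+ s * p%:Z * b]%R)%N = multiples p q.
Proof.
move=> p0 q0 pq; rewrite sum_nat_of_bool2; symmetry.
apply: (@count_image _ _ (fun g => (g * p%:Z, (-1) ^+ s * g * q%:Z))).
- exact: uniq_zseq.
- by rewrite allpairs_uniq ?uniq_zseq // => -[? ?] [? ?] _ _ [-> ->].
- move=> g h _ _ [/mulIf e _]; apply: e; lia.
have ss : (-1) ^+ s * (-1) ^+ s = 1 :> int by rewrite -expr2 sqrr_sign.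
move=> [x b]; apply: (iffP andP) => [|[g /andP[gJ /and3P[g0 g1 g2]]] [-> ->]].
  case=> /allpairsP[[x' b'] /= [xJ bJ [-> ->]]] /and5P[Ix Bb x0 b0 /eqP e].
  (* [q] divides [p b'] and is coprime to [p]. The quotient of [b'] by [q], corrected by the sign,
     is the multiplier g. *)
  have : (q%:Z %| b')%Z.
    rewrite -(@Gauss_dvdzr _ p%:Z) ?coprimezE ?absz_nat 1?coprime_sym //.
    apply/dvdzP; exists ((-1) ^+ s * x'); rewrite -mulrA e !mulrA ss; ring.
  case/dvdzP => h hE; exists ((-1) ^+ s * h).
    have xE : x' = (-1) ^+ s * h * p%:Z.
      have q0' : q%:Z != 0 by lia.
      by apply: (mulIf q0'); rewrite e hE; ring.
    have ng (z : int) : `|(-1) ^+ s * z| = `|z|.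
      by rewrite normrM normrX normrN1 expr1n mul1r.
    apply/andP; split.
      rewrite mem_zseq ng; move: bJ; rewrite mem_zseq; apply: le_trans.
      by rewrite hE normrM ler_peMr //; lia.
    apply/and3P; split.
    - rewrite mulf_neq0 ?signr_eq0 //.
      by apply: contra_neq b0 => h0; rewrite hE h0 mul0r.
    - by rewrite -xE.
    - by rewrite -mulrA ng -hE.
  have q0' : q%:Z != 0 by lia.
  rewrite mulrA ss mul1r -hE; congr (_, _).
  by apply: (mulIf q0'); rewrite e hE; ring.
have nb : `|(-1) ^+ s * g * q%:Z| = `|g * q%:Z|.
  by rewrite -mulrA normrM normrX normrN1 expr1n mul1r.
split.
  apply/allpairsP; exists (g * p%:Z, (-1) ^+ s * g * q%:Z); split=> //=.
    by rewrite mem_zseq /n; lia.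
  by rewrite mem_zseq nb /n; lia.
rewrite /I /B nb g1 g2 /=.
rewrite !mulf_neq0 ?signr_eq0 //=; try lia.
apply/eqP; transitivity ((-1) ^+ s * (-1) ^+ s * (g * p%:Z * q%:Z)); last by ring.
by rewrite ss mul1r.
Qed.

(** Once x : b = +-p : q is fixed by [sum_signed_ratio], the equation x y = b c means y : c = +-q :
    p with the same sign. The conditions on (x, b) and (y, c) then separate, each sum is given by
    [signed_pairs], and the two signs contribute equally. *)
Lemma quad_nonzero :
  quad (fun x b y c => [&& x != 0, b != 0, y != 0, c != 0 & x * y == b * c])%R
  = (2 * \sum_(1 <= p < n.+1) \sum_(1 <= q < n.+1 | coprime p q)
      multiples p q * multiples q p)%N.
Proof.
pose A (s : bool) (p q : nat) (x b : int) : nat :=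
  [&& x != 0, b != 0 & x * q%:Z == (-1) ^+ s * p%:Z * b].
have term x b y c : I x -> B b -> I y -> B c ->
  ([&& x != 0, b != 0, y != 0, c != 0 & x * y == b * c] : nat) =
  (\sum_(s : bool) \sum_(1 <= p < n.+1) \sum_(1 <= q < n.+1 | coprime p q)
     A s p q x b * A s q p y c)%N.
  move=> Ix Bb Iy Bc.
  case: (boolP [&& x != 0, b != 0, y != 0 & c != 0]) => [/and4P[x0 b0 y0 c0]|h0].
    have xn : `|x| <= n%:Z by move: Ix; rewrite /I /n; lia.
    have bn : `|b| <= n%:Z by move: Bb; rewrite /B /n; lia.
    transitivity ((x * y == b * c)%R * (\sum_(s : bool) \sum_(1 <= p < n.+1)
       \sum_(1 <= q < n.+1 | coprime p q) (x * q%:Z == (-1) ^+ s * p%:Z * b)%R))%N.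
      by rewrite (sum_signed_ratio x0 b0 xn bn) muln1 x0 b0 y0 c0.
    rewrite big_distrr; apply: eq_bigr => s _ /=.
    rewrite big_distrr big_nat [RHS]big_nat; apply: eq_bigr => p /andP[p1 _] /=.
    rewrite big_distrr big_nat_cond [RHS]big_nat_cond.
    apply: eq_bigr => q /andP[/andP[q1 _] _] /=.
    rewrite /A x0 b0 y0 c0 /= mulnC.
    case: eqP => //= e; rewrite !mul1n; congr (nat_of_bool _).
    have ss : (-1) ^+ s * (-1) ^+ s = 1 :> int by rewrite -expr2 sqrr_sign.
    have q0' : q%:Z != 0 by lia.
    (* The defects of the two equations agree up to the nonzero factors [b] and +-[q], so one
       vanishes exactly when the other does. *)
    have key : b * (y * p%:Z - (-1) ^+ s * q%:Z * c) = (-1) ^+ s * (x * y - b * c) * q%:Z.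
      have -> : (-1) ^+ s * (x * y - b * c) * q%:Z =
         (-1) ^+ s * (x * q%:Z) * y - (-1) ^+ s * b * c * q%:Z by ring.
      rewrite e !mulrA ss; ring.
    rewrite -[RHS]subr_eq0 -[LHS]subr_eq0.
    apply/idP/idP => /eqP h.
      by move: key; rewrite h mulr0 mul0r => /eqP; rewrite mulf_eq0 (negbTE b0).
    move: key; rewrite h mulr0 => /esym /eqP.
    by rewrite !mulf_eq0 signr_eq0 (negbTE q0') orbF.
  rewrite big1 => [|s _].
    by move: h0; case: (x != 0); case: (b != 0); case: (y != 0); case: (c != 0).
  rewrite big1 // => p _; rewrite big1 // => q _; rewrite /A.
  by move: h0; case: (x != 0); case: (b != 0); case: (y != 0); case: (c != 0);
    rewrite //= ?muln0.
transitivity (quad (fun x b y c =>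
   \sum_(s : bool) \sum_(1 <= p < n.+1) \sum_(1 <= q < n.+1 | coprime p q)
     A s p q x b * A s q p y c))%N.
  apply: eq_bigr => x Ix; apply: eq_bigr => b Bb.
  by apply: eq_bigr => y Iy; apply: eq_bigr => c Bc; exact: term.
transitivity (\sum_(s : bool) \sum_(1 <= p < n.+1) \sum_(1 <= q < n.+1 | coprime p q)
  quad (fun x b y c => A s p q x b * A s q p y c))%N.
  rewrite /quad.
  have exchange (T : Type) (r : seq T) (P : pred T) (F : bool -> nat -> nat -> T -> nat) :
    (\sum_(t <- r | P t) \sum_(s : bool) \sum_(1 <= p < n.+1)
      \sum_(1 <= q < n.+1 | coprime p q) F s p q t =
     \sum_(s : bool) \sum_(1 <= p < n.+1) \sum_(1 <= q < n.+1 | coprime p q)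
       \sum_(t <- r | P t) F s p q t)%N.
    rewrite exchange_big; apply: eq_bigr => s _.
    by rewrite exchange_big; apply: eq_bigr => p _; rewrite exchange_big.
  rewrite -exchange; apply: eq_bigr => x _; rewrite -exchange; apply: eq_bigr => b _.
  by rewrite -exchange; apply: eq_bigr => y _; rewrite -exchange.
rewrite -[2%N]card_bool -sum_nat_const; apply: eq_bigr => s _.
rewrite big_nat [RHS]big_nat; apply: eq_bigr => p /andP[p1 _].
rewrite big_nat_cond [RHS]big_nat_cond; apply: eq_bigr => q /andP[/andP[q1 _] pq].
rewrite -(signed_pairs s p1 q1 pq) -(signed_pairs s q1 p1); last by rewrite coprime_sym.
rewrite /quad big_distrl; apply: eq_bigr => x _; rewrite big_distrl.
apply: eq_bigr => b _ /=; rewrite big_distrr; apply: eq_bigr => y _ /=.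
by rewrite big_distrr.
Qed.

End Fixed.

(** Reflection in the diagonal doubles the triangle p <= q; the only coprime pair on the diagonal is
    (1, 1), which is then counted twice. *)
Lemma sum_coprime_sym (F : nat -> nat -> nat) m : (forall p q, F p q = F q p) ->
  (0 < m)%N ->
  (\sum_(1 <= p < m.+1) \sum_(1 <= q < m.+1 | coprime p q) F p q + F 1 1 =
   2 * \sum_(1 <= q < m.+1) \sum_(1 <= p < q.+1 | coprime p q) F p q)%N.
Proof.
move=> FC; case: m => // m _; elim: m => [|m IH].
  rewrite !big_nat1 !(big_mkcond (coprime _)) (big_mkcond (coprime^~ _)).
  by rewrite !big_nat1 mul2n addnn.
rewrite [in RHS]big_nat_recr //= mulnDr -IH.
have split1 G : (\sum_(1 <= q < m.+3 | G q) F m.+2 q =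
   \sum_(1 <= q < m.+2 | G q) F m.+2 q + (if G m.+2 then F m.+2 m.+2 else 0))%N.
  by rewrite big_mkcond big_nat_recr //= -big_mkcond.
have cc : coprime m.+2 m.+2 = false by rewrite /coprime gcdnn.
have -> : (\sum_(1 <= p < m.+3 | coprime p m.+2) F p m.+2 =
   \sum_(1 <= p < m.+2 | coprime p m.+2) F p m.+2)%N.
  by rewrite big_mkcond big_nat_recr //= -big_mkcond cc addn0.
rewrite big_nat_recr //= split1 cc addn0.
have -> : (\sum_(1 <= p < m.+2) \sum_(1 <= q < m.+3 | coprime p q) F p q =
  \sum_(1 <= p < m.+2) \sum_(1 <= q < m.+2 | coprime p q) F p q +
  \sum_(1 <= p < m.+2 | coprime p m.+2) F p m.+2)%N.
  rewrite [X in (_ = _ + X)%N]big_mkcond -big_split; apply: eq_bigr => p _ /=.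
  by rewrite big_mkcond big_nat_recr //= -big_mkcond.
have -> : (\sum_(1 <= q < m.+2 | coprime m.+2 q) F m.+2 q =
   \sum_(1 <= p < m.+2 | coprime p m.+2) F p m.+2)%N.
  by apply: eq_big => q; rewrite 1?coprime_sym // FC.
lia.
Qed.

End Counting.

(** * Matrices with a given eigenvalue *)

Lemma det_mx22 (K : comRingType) (A : 'M[K]_2) :
  \det A = A 0 0 * A 1 1 - A 0 1 * A 1 0.
Proof.
rewrite (expand_det_row _ 0) !big_ord_recl big_ord0 /cofactor !det_mx11 !mxE.
have -> : lift 0 0 = 1 :> 'I_2 by exact: val_inj.
have -> : lift 1 0 = 0 :> 'I_2 by exact: val_inj.
by rewrite /= expr0 expr1 addr0 mul1r mulN1r mulrN.
Qed.

Section Matrices.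
Variables (k : nat) (l : int).

(** A nonzero kernel means that M - l has determinant zero; the 2 x 2 determinant is expanded and
    the equation pulled back from the rationals to the integers. *)
Lemma eigenvalueE (M : 'M[int]_2) :
  eigenvalue (map_mx (intr : int -> rat) M) l%:~R =
  ((l - M 0 0) * (l - M 1 1) == M 0 1 * M 1 0).
Proof.
rewrite /eigenvalue /eigenspace kermx_eq0 row_free_unit unitmxE unitfE negbK.
set A := (X in \det X).
have -> : \det A = A 0 0 * A 1 1 - A 0 1 * A 1 0.
  exact: det_mx22.
rewrite !mxE /= mulr1n !mulr0n !subr0 subr_eq0.
rewrite -[RHS](inj_eq (intr_inj : injective (intr : int -> rat))).
rewrite !rmorphM !rmorphB /= -[in RHS]mulrNN !opprB.
done.
Qed.

(** Both diagonal entries of l - M exceed k in absolute value, whereas the product of the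
    off-diagonal ones is at most k^2. *)
Lemma M2eig_eq0 : (2 * k%:Z < `|l|) -> M2eig k l = set0.
Proof.
move=> hl; apply/seteqP; split=> M //= [hM]; rewrite eigenvalueE => /eqP e.
have h00 := hM 0 0; have h11 := hM 1 1; have h01 := hM 0 1; have h10 := hM 1 0.
have h1 : k%:Z + 1 <= `|l - M 0 0| by lia.
have h2 : k%:Z + 1 <= `|l - M 1 1| by lia.
have : (k%:Z + 1) * (k%:Z + 1) <= k%:Z * k%:Z.
  apply: le_trans (_ : `|l - M 0 0| * `|l - M 1 1| <= _); first by rewrite ler_pM.
  by rewrite -normrM e normrM ler_pM.
nia.
Qed.

(** The quadruple (x, b, y, c) corresponds to the matrix [[l - x, b], [c, l - y]], injectively, so
    the set is enumerated by a list without repetition. *)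
Lemma card_M2eig : `|l| <= 2 * k%:Z ->
  #|` fset_set (M2eig k l)| = quad k l (fun x b y c => x * y == b * c)%R.
Proof.
move=> hl; pose J := zseq (3 * k).
pose P := [seq (x, b) | x <- J, b <- J].
pose ok (u : int * int) := (`|l - u.1| <= k%:Z) && (`|u.2| <= k%:Z).
pose c4 (w : (int * int) * (int * int)) :=
  [&& ok w.1, ok w.2 & w.1.1 * w.2.1 == w.1.2 * w.2.2].
have uP : uniq P by rewrite allpairs_uniq ?uniq_zseq // => -[? ?] [? ?] _ _ [-> ->].
pose Q := [seq (u, v) | u <- P, v <- P].
have uQ : uniq Q by rewrite allpairs_uniq // => -[? ?] [? ?] _ _ [-> ->].
have -> : quad k l (fun x b y c => x * y == b * c)%R = size (seq.filter c4 Q).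
  rewrite size_filter -sum_nat_of_bool big_allpairs big_allpairs.
  rewrite /quad [LHS]big_mkcond. apply: eq_bigr => x _ /=.
  case: ifPn => hx; last first.
    rewrite big1 // => b _; rewrite big1 // => v _.
    by rewrite /c4 /ok /= (negbTE hx).
  rewrite [LHS]big_mkcond; apply: eq_bigr => b _ /=.
  case: ifPn => hb; last first.
    by rewrite big1 // => v _; rewrite /c4 /ok /= (negbTE hb) andbF.
  rewrite big_allpairs [LHS]big_mkcond; apply: eq_bigr => y _ /=.
  case: ifPn => hy; last first.
    by rewrite big1 // => c _; rewrite /c4 /ok /= (negbTE hy) andbF.
  rewrite [LHS]big_mkcond; apply: eq_bigr => c _ /=.
  rewrite /c4 /ok /= hx hb hy /=.
  by case: (`|c| <= k%:Z).
pose f (w : (int * int) * (int * int)) : 'M[int]_2 :=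
  \matrix_(i, j) (if i == 0 then if j == 0 then l - w.1.1 else w.1.2
                  else if j == 0 then w.2.2 else l - w.2.1).
have f00 w : f w 0 0 = l - w.1.1 by rewrite mxE.
have f01 w : f w 0 1 = w.1.2 by rewrite mxE.
have f10 w : f w 1 0 = w.2.2 by rewrite mxE.
have f11 w : f w 1 1 = l - w.2.1 by rewrite mxE.
have fI : injective f.
  move=> [[x b] [y c]] [[x' b'] [y' c']] e.
  have e00 := congr1 (fun M : 'M[int]_2 => M 0 0) e.
  have e01 := congr1 (fun M : 'M[int]_2 => M 0 1) e.
  have e10 := congr1 (fun M : 'M[int]_2 => M 1 0) e.
  have e11 := congr1 (fun M : 'M[int]_2 => M 1 1) e.
  rewrite !f00 !f01 !f10 !f11 /= in e00 e01 e10 e11.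
  have -> : x = x' by move: e00 => /addrI /oppr_inj.
  have -> : y = y' by move: e11 => /addrI /oppr_inj.
  by rewrite e01 e10.
suff -> : fset_set (M2eig k l) = [fset M in map f (seq.filter c4 Q)]%fset.
  by rewrite card_fseq undup_id ?size_map // map_inj_uniq ?filter_uniq.
apply/fsetP => M.
rewrite in_fset_set; last exact: finite_M2eig.
rewrite inE; apply/idP/mapP.
  move=> /set_mem [hM]; rewrite eigenvalueE => /eqP e.
  have h00 : `|M 0 0| <= k%:Z by exact: hM.
  have h01 : `|M 0 1| <= k%:Z by exact: hM.
  have h10 : `|M 1 0| <= k%:Z by exact: hM.
  have h11 : `|M 1 1| <= k%:Z by exact: hM.
  exists ((l - M 0 0, M 0 1), (l - M 1 1, M 1 0)).
    rewrite mem_filter; apply/andP; split.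
      by rewrite /c4 /ok /= !subKr h00 h01 h10 h11 e eqxx.
    by apply: allpairs_f; apply: allpairs_f; rewrite mem_zseq; lia.
  apply/matrixP => i j; rewrite mxE /=.
  have I2 (o : 'I_2) : o = 0 \/ o = 1.
    by case: o => -[|[|//]] h; [left|right]; exact: val_inj.
  by case: (I2 i) => ->; case: (I2 j) => -> /=; rewrite ?subKr.
move=> [w]; rewrite mem_filter => /andP[/and3P[/andP[h1 h2] /andP[h3 h4] /eqP h5] _] ->.
apply/mem_set; split; last by rewrite eigenvalueE f00 f01 f10 f11 !subKr h5 eqxx.
move=> i j; rewrite mxE; by case: ifP => _; case: ifP.
Qed.

End Matrices.

(** * Asymptotics *)

Section Main.
Variable R : realType.

Lemma count_zseq_real n (A B : R) :
  (forall g : int, A <= g%:~R <= B -> `|g| <= n%:Z) ->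
  `|(count (fun g : int => A <= g%:~R <= B) (zseq n))%:R - Num.max 0 (B - A)| <= 1.
Proof.
move=> h.
have e (g : int) : (A <= g%:~R <= B) = (Num.ceil A <= g <= Num.floor B).
  by rewrite ceil_le_int floor_ge_int.
rewrite (eq_count e).
have /andP[a1 a2] := ceil_itv A; have /andP[b1 b2] := floor_itv B.
rewrite intrB in a1; rewrite intrD in b2.
have hc := @count_zseq_itv n (Num.ceil A) (Num.floor B).
have {}hc := hc (fun g hg => h g (etrans (e g) hg)).
rewrite -[(count _ _)%:R]/((count _ _)%:Z%:~R) hc.
case: ifPn => ab.
  rewrite intrD intrB; have : (Num.ceil A)%:~R <= (Num.floor B)%:~R :> R by rewrite ler_int.
  rewrite ler_norml => ab'.
  have -> : Num.max 0 (B - A) = B - A by apply/max_idPr; lra.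
  lra.
have ab' : (Num.floor B)%:~R + 1 <= (Num.ceil A)%:~R :> R.
  by rewrite -[1]/(1%:~R) -intrD ler_int; lia.
have m0 : 0 <= Num.max 0 (B - A) by rewrite le_max lexx.
rewrite sub0r normrN ger0_norm // ge_max ler01 /=; lra.
Qed.

(** The g in question are the integers of a real interval, apart from g = 0: one unit of error for
    counting integers by length, one for the excluded zero. *)
Lemma multiples_ell k (l : int) p q : (0 < k)%N -> (0 < p)%N -> (0 < q)%N ->
  `|(multiples k l p q)%:R - k%:R * ell (l%:~R / k%:R) p%:R q%:R| <= 2 :> R.
Proof.
move=> k0 p0 q0; pose J := zseq (3 * k).
have k0' : 0 < k%:R :> R by rewrite ltr0n.
have p0' : 0 < p%:R :> R by rewrite ltr0n.
have q0' : 0 < q%:R :> R by rewrite ltr0n.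
pose A : R := Num.max ((l%:~R - k%:R) / p%:R) (- (k%:R / q%:R)).
pose B : R := Num.min ((l%:~R + k%:R) / p%:R) (k%:R / q%:R).
have e (g : int) : (`|l - g * p%:Z| <= k%:Z) && (`|g * q%:Z| <= k%:Z) = (A <= g%:~R <= B).
  rewrite ge_max le_min !ler_norml -!(ler_int R) !rmorphN !rmorphB !rmorphM /=.
  rewrite ler_pdivrMr // ler_pdivlMr // ler_pdivlMr //.
  have -> : ((- (k%:R / q%:R) : R) <= g%:~R) = ((- k%:R : R) <= g%:~R * q%:R).
    by rewrite -mulNr ler_pdivrMr.
  rewrite -!pmulrn; apply/idP/idP; lra.
have -> : k%:R * ell (l%:~R / k%:R) p%:R q%:R = Num.max 0 (B - A) :> R.
  rewrite /ell maxr_pMr ?ler0n // mulr0 mulrBr maxr_pMr ?ler0n // minr_pMr ?ler0n //.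
  rewrite mulrN; congr (Num.max 0 (Num.min _ _ - Num.max _ _)).
    by field; rewrite !gt_eqF.
  by field; rewrite !gt_eqF.
have h (g : int) : A <= g%:~R <= B -> `|g| <= (3 * k)%N%:Z.
  rewrite -e => /andP[_]; rewrite normrM => hg.
  have : `|g| * 1 <= `|g| * `|q%:Z| by rewrite ler_wpM2l //; lia.
  by move: hg; rewrite mulr1; move: (`|g| * _) => z; lia.
have := count_zseq_real h; rewrite -/J.
have -> : count (fun g : int => A <= g%:~R <= B) J =
    (multiples k l p q + count (fun g : int => (g == 0) && (A <= g%:~R <= B))%R J)%N.
  rewrite /multiples -/J -!sum_nat_of_bool -big_split; apply: eq_bigr => g _ /=.
  by rewrite e; case: (g == 0); case: (A <= _ <= _).
have : (count (fun g : int => (g == 0) && (A <= g%:~R <= B))%R J <= 1)%N.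
  apply: leq_trans (_ : count_mem 0%R J <= 1)%N.
    by apply: sub_count => g /andP[].
  by rewrite count_uniq_mem ?uniq_zseq // leq_b1.
move: (count _ _) (multiples _ _ _ _) (Num.max _ _) => c m M c1.
have c1' : c%:R <= 1 :> R by rewrite -[1]/(1%:R) ler_nat.
have c0 : 0 <= c%:R :> R by [].
by rewrite natrD !ler_norml; lra.
Qed.

Lemma multiples_le k (l : int) p q : (0 < p)%N -> (0 < q)%N ->
  (multiples k l p q <= k.*2.+1)%N.
Proof.
move=> p0 q0; apply: leq_trans (count_zseq_ball (3 * k) 0 k).
apply: sub_count => g /= /and3P[_ _].
rewrite sub0r normrN normrM => hg.
have : `|g| * 1 <= `|g| * `|q%:Z| by rewrite ler_wpM2l //; lia.
by move: hg; rewrite mulr1; move: (`|g| * _) => z; lia.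
Qed.

Lemma ell_norm (d p q : R) : ell `|d| p q = ell d p q.
Proof. by case: (ler0P d) => _; rewrite ?ellN. Qed.

(** Both lengths are at most 2 k / q and both counts are off by at most 2. Expanding the product
    about the lengths leaves 2 * 2 plus twice 2 * (2 k / q). *)
Lemma multiples_mul_ell k (l : int) p q (d : R) : d = `|l%:~R / k%:R| ->
  (0 < k)%N -> (0 < p)%N -> (p <= q)%N ->
  `|(multiples k l p q * multiples k l q p)%N%:R
    - k%:R ^+ 2 * (ell d p%:R q%:R * ell d q%:R p%:R)| <= 8 * k%:R / q%:R + 4.
Proof.
move=> dE k0 p0 pq; have q0 : (0 < q)%N by exact: leq_trans pq.
have k0' : 0 < k%:R :> R by rewrite ltr0n.
have p0' : 0 < p%:R :> R by rewrite ltr0n.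
have q0' : 0 < q%:R :> R by rewrite ltr0n.
have h1 := multiples_ell l k0 p0 q0; have h2 := multiples_ell l k0 q0 p0.
rewrite -ell_norm -dE in h1; rewrite -ell_norm -dE in h2.
have [_ u1] := ell_leV d p0' q0'; have [u2 _] := ell_leV d q0' p0'.
have v1 := ell_ge0 d p%:R q%:R; have v2 := ell_ge0 d q%:R p%:R.
have {}u1 : k%:R * ell d p%:R q%:R <= 2 * (k%:R / q%:R).
  by rewrite mulrCA ler_pM2l.
have {}u2 : k%:R * ell d q%:R p%:R <= 2 * (k%:R / q%:R).
  by rewrite mulrCA ler_pM2l.
have {}v1 : 0 <= k%:R * ell d p%:R q%:R by rewrite mulr_ge0.
have {}v2 : 0 <= k%:R * ell d q%:R p%:R by rewrite mulr_ge0.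
have -> : k%:R ^+ 2 * (ell d p%:R q%:R * ell d q%:R p%:R) =
  (k%:R * ell d p%:R q%:R) * (k%:R * ell d q%:R p%:R) by ring.
rewrite natrM -[8 * k%:R / q%:R]mulrA.
move: (k%:R / q%:R) u1 u2 h1 h2 v1 v2 => z u1 u2 h1 h2 v1 v2; move: u1 u2 h1 h2 v1 v2.
move: (multiples k l p q)%:R (multiples k l q p)%:R (k%:R * ell d p%:R q%:R)
  (k%:R * ell d q%:R p%:R) => a b x y u1 u2 h1 h2 v1 v2.
have -> : a * b - x * y = (a - x) * (b - y) + (a - x) * y + x * (b - y) by ring.
have -> : 8 * z + 4 = 2 * 2 + 2 * (2 * z) + (2 * z) * 2 :> R by ring.
rewrite (le_trans (ler_normD _ _)) // lerD //; last by rewrite normrM ler_pM // ger0_norm.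
rewrite (le_trans (ler_normD _ _)) // lerD //; first by rewrite normrM ler_pM.
by rewrite normrM ler_pM // [ `|y| ]ger0_norm.
Qed.

(** A summand vanishes as soon as p or q exceeds k, by [multiples_eq0]; the remaining square is
    folded along its diagonal. *)
Lemma sum_multiples k (l : int) : (0 < k)%N ->
  (\sum_(1 <= p < (3 * k).+1) \sum_(1 <= q < (3 * k).+1 | coprime p q)
      multiples k l p q * multiples k l q p + multiples k l 1 1 * multiples k l 1 1 =
   2 * \sum_(1 <= q < k.+1) \sum_(1 <= p < q.+1 | coprime p q)
      multiples k l p q * multiples k l q p)%N.
Proof.
move=> k0; pose F p q := (multiples k l p q * multiples k l q p)%N.
rewrite -(@sum_coprime_sym F k) //; last by move=> p q; rewrite /F mulnC.
congr (_ + _)%N.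
have kk : (k.+1 <= (3 * k).+1)%N by lia.
rewrite (@big_cat_nat _ _ _ k.+1) //= [X in (_ + X)%N]big_nat [X in (_ + X)%N]big1 ?addn0.
  apply: eq_bigr => p _.
  rewrite big_mkcond (@big_cat_nat _ _ _ k.+1) //= -big_mkcond.
  rewrite [X in (_ + X)%N]big_nat [X in (_ + X)%N]big1 ?addn0 // => q /andP[q1 _].
  by case: ifP => // _; rewrite (multiples_eq0 _ _ q1).
move=> p /andP[p1 _]; rewrite big1 // => q _.
by rewrite [multiples k l q p]multiples_eq0 // muln0.
Qed.

Lemma count_asymptotic k (l : int) : (0 < k)%N -> `|l| <= 2 * k%:Z ->
  `|(#|` fset_set (M2eig k l)|)%:R
     - 24 * V (l%:~R / k%:R) / pi ^+ 2 * k%:R ^+ 2 * ln k%:R | <= 4006 * k%:R ^+ 2 :> R.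
Proof.
move=> k0 hl; rewrite card_M2eig //.
have k1 : 1 <= k%:R :> R by rewrite ler1n.
have k0' : 0 < k%:R :> R by lra.
have k9 (x : R) : 1 <= x -> (2 * x + 1) ^+ 2 <= 9 * x ^+ 2.
  move=> x1; have : 0 <= (5 * x + 1) * (x - 1) by rewrite mulr_ge0; lra.
  lra.
pose d : R := `|l%:~R / k%:R|.
have Vd : V (l%:~R / k%:R) = V d :> R by rewrite /V normr_id.
have d02 : 0 <= d <= 2.
  rewrite normr_ge0 /d normrM normfV [ `|k%:R| ]gtr0_norm // ler_pdivrMr //.
  by rewrite -intr_norm -[2 * k%:R]/(2%:~R * k%:~R) -intrM ler_int.
have := quad_zero_le k l; rewrite quad_nonzero // => up.
have lo : (2 * (\sum_(1 <= p < (3 * k).+1) \sum_(1 <= q < (3 * k).+1 | coprime p q)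
     multiples k l p q * multiples k l q p) <=
   quad k l (fun x b y c => (x * y == b * c)%R))%N.
  rewrite -quad_nonzero //; apply: quad_le => x b y c _ _ _ _.
  by case: (x == 0); case: (b == 0); case: (y == 0); case: (c == 0).
have := @sum_multiples k l k0.
have m1 : (multiples k l 1 1 * multiples k l 1 1 <= k.*2.+1 * k.*2.+1)%N.
  by rewrite leq_mul // multiples_le.
move: (bigop _ _ _) up lo => P up lo.
set S := (X in (2 * X)%N) => PS.
pose U : R := \sum_(1 <= q < k.+1) \sum_(1 <= p < q.+1 | coprime p q)
  ell d p%:R q%:R * ell d q%:R p%:R.
(* Row q has q entries with error at most 8 k / q + 4, hence costs 8 k + 4 q <= 12 k, and there are
   k rows. *)
have hS : `|S%:R - k%:R ^+ 2 * U| <= 12 * k%:R ^+ 2.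
  rewrite /S /U natr_sum mulr_sumr -sumrB.
  apply: le_trans (ler_norm_sum _ _ _) _.
  apply: le_trans (_ : \sum_(1 <= q < k.+1) 12 * k%:R <= _); last first.
    by rewrite sumr_const_nat subn1 /= -[(12 * _) *+ _]mulr_natr -mulrA -expr2.
  rewrite big_nat [leRHS]big_nat; apply: ler_sum => q /andP[q1 qk].
  have q0' : 0 < q%:R :> R by rewrite ltr0n.
  rewrite natr_sum mulr_sumr -sumrB.
  apply: le_trans (ler_norm_sum _ _ _) _.
  apply: le_trans (_ : \sum_(1 <= p < q.+1) (8 * k%:R / q%:R + 4) <= _).
    rewrite big_mkcond big_nat [leRHS]big_nat; apply: ler_sum => p /andP[p1 pq].
    case: ifP => _; first exact: multiples_mul_ell.
    by rewrite addr_ge0 ?divr_ge0 ?mulr_ge0.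
  rewrite sumr_const_nat subn1 /= -[(_ + 4) *+ _]mulr_natr mulrDl divfK ?gt_eqF //.
  have : q%:R <= k%:R :> R by rewrite ler_nat.
  lra.
have hU : `|U - 6 * V d / pi ^+ 2 * ln k%:R| <= 976 by exact: coprime_sum_profile.
rewrite Vd; clearbody U.
set N := quad _ _ _ in up lo *.
have oddE : k.*2.+1%:R = 2 * k%:R + 1 :> R by rewrite -natr1 -mul2n natrM.
have upR : N%:R <= 2 * P%:R + 4 * (2 * k%:R + 1) ^+ 2 :> R.
  move: up; rewrite -(ler_nat R) natrD [(2 * P)%:R]natrM [(4 * _)%:R]natrM natrX oddE.
  exact.
have loR : 2 * P%:R <= N%:R :> R by rewrite -natrM ler_nat.
have PSR : P%:R + (multiples k l 1 1 * multiples k l 1 1)%N%:R = 2 * S%:R :> R.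
  by rewrite -natrD PS natrM.
have m1R : (multiples k l 1 1 * multiples k l 1 1)%N%:R <= (2 * k%:R + 1) ^+ 2 :> R.
  by move: m1; rewrite -(ler_nat R) [(k.*2.+1 * _)%:R]natrM oddE -expr2.
have m0R : 0 <= (multiples k l 1 1 * multiples k l 1 1)%N%:R :> R by [].
move: N (_ * multiples _ _ _ _)%N upR loR PSR m1R m0R {up lo PS m1} => N m upR loR PSR m1R m0R.
have {}k9 := k9 _ k1.
have -> : 24 * V d / pi ^+ 2 * k%:R ^+ 2 * ln k%:R =
   4 * k%:R ^+ 2 * (6 * V d / pi ^+ 2 * ln k%:R).
  by move: (V d) (pi ^+ 2)^-1 => v e; ring.
move: (6 * V d / pi ^+ 2 * ln k%:R) hU => W hU.
clear Vd d02.
have {}hU : `|k%:R ^+ 2 * U - k%:R ^+ 2 * W| <= 976 * k%:R ^+ 2.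
  by rewrite -mulrBr normrM ger0_norm ?exprn_ge0 ?ler0n // mulrC ler_pM2r ?exprn_gt0.
(* The constant collects 4 * 976 from the coprime sum, 4 * 12 from rounding, 4 * 9 from the zero
   entries and 2 * 9 from the pair (1, 1), using (2 k + 1)^2 <= 9 k^2. *)
rewrite -mulrA; move: hS hU k9 upR m1R; rewrite !ler_norml.
move: (k%:R ^+ 2 * U) (k%:R ^+ 2 * W) (k%:R ^+ 2) ((2 * k%:R + 1) ^+ 2).
move: N%:R P%:R S%:R m%:R loR PSR m0R => {}N {}P s {}m loR PSR m0R u w kk z.
clear -loR PSR m0R; lra.
Qed.

End Main.

Theorem theorem1 (R : realType) :
  (exists C : R, forall (k : nat) (l : int), (1 <= k)%N ->
     - (2 * k%:Z) <= l <= 2 * k%:Z ->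
     `| (#|` fset_set (M2eig k l)|)%:R
        - 24 * V (l%:~R / k%:R) / pi ^+ 2 * k%:R ^+ 2 * ln k%:R |
       <= C * k%:R ^+ 2)
  /\
  (forall (k : nat) (l : int), (1 <= k)%N ->
     2 * k%:Z < `|l| -> M2eig k l = set0).
Proof.
split=> [|k l _]; last exact: M2eig_eq0.
by exists 4006 => k l k0; rewrite -ler_norml; exact: count_asymptotic.
Qed.
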